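(* Let $W$ be a finite irreducible Coxeter group with Coxeter number $h$, and let $W_\equiv$ be a lattice quotient of $\mathrm{Weak}(W)$. Then $\max_{x\in W_\equiv}\lvert\mathcal{O}_{W_\equiv}(x)\rvert\le h$.
   Context: $\mathrm{Weak}(W)$ is the right weak order on $W$: $u\le v$ iff some reduced word for $v$ has a reduced word for $u$ as a prefix. The Coxeter number $h$ is the common order of the Coxeter elements (products of all simple reflections, each once). A lattice quotient of a lattice $L$ is a lattice $L'$ admitting a surjective lattice homomorphism $L\to L'$ (a map preserving meets and joins). For a finite lattice $L$, $\mathrm{pop}^{\downarrow}_L(x)=x\wedge\bigwedge\{y:y\lessdot x\}$ and $\mathcal{O}_L(x)=\{x,\mathrm{pop}^{\downarrow}_L(x),(\mathrm{pop}^{\downarrow}_L)^2(x),\ldots\}$ is the forward orbit of $x$. *)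

(* Defs.v *)
From HB Require Import structures.
From mathcomp Require Import all_boot all_order all_fingroup.
Set Implicit Arguments. Unset Strict Implicit. Unset Printing Implicit Defensive.
Import Order.TTheory.

Section Coxeter.
Local Open Scope group_scope.
Variable gT : finGroupType.
Implicit Types (S : {set gT}) (x y u v z : gT) (w : seq gT).

(* Coxeter system (W,S) with W := <<S>> : S is a set of involutions, and W has
   the presentation < S | (s t)^{m(s,t)} = 1 > where m(s,t) = #[s*t] is the
   order of s t in W.  The presentation is expressed by the universal property
   with respect to every (possibly infinite) group (H, mul, one, inv). *)
Definition coxeter_system S : Prop :=
  (forall s, s \in S -> s != 1 /\ s ^+ 2 = 1) /\
  forall (H : Type) (mul : H -> H -> H) (one : H) (inv : H -> H),
    associative mul -> left_id one mul -> left_inverse one inv mul ->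
    forall f : gT -> H,
      (forall s t, s \in S -> t \in S ->
         iter #[s * t] (mul (mul (f s) (f t))) one = one) ->
      exists phi : gT -> H,
        {in <<S>> &, forall x y, phi (x * y) = mul (phi x) (phi y)} /\
        {in S, phi =1 f}.

Definition coxeter_graph S : rel gT :=
  fun s t => [&& s \in S, t \in S & 3 <= #[s * t]].

Definition irreducible_coxeter S : Prop :=
  S != set0 /\ forall s t, s \in S -> t \in S -> connect (coxeter_graph S) s t.

(* the Coxeter number: order of a Coxeter element (product of all simple
   reflections, each once; all such have the same order) *)
Definition coxeter_number S : nat := #[\prod_(s <- enum S) s].

Definition word_prod w : gT := \prod_(s <- w) s.
Definition is_word S w : bool := all (fun s => s \in S) w.

Definition reduced_word S w : Prop :=
  is_word S w /\ forall w', is_word S w' -> word_prod w' = word_prod w ->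
                           size w <= size w'.

Definition weak_le S u v : Prop :=
  exists w, [/\ reduced_word S w, word_prod w = v &
    exists k, reduced_word S (take k w) /\ word_prod (take k w) = u].

Definition weak_is_meet S u v z : Prop :=
  [/\ weak_le S z u, weak_le S z v &
      forall t, t \in <<S>> -> weak_le S t u -> weak_le S t v -> weak_le S t z].
Definition weak_is_join S u v z : Prop :=
  [/\ weak_le S u z, weak_le S v z &
      forall t, t \in <<S>> -> weak_le S u t -> weak_le S v t -> weak_le S z t].

Definition weak_lattice_quotient_map S (d : Order.disp_t)
  (L : finLatticeType d) (f : gT -> L) : Prop :=
  [/\ forall y : L, exists2 x, x \in <<S>> & f x = y,
      forall u v z, u \in <<S>> -> v \in <<S>> -> z \in <<S>> ->
        weak_is_meet S u v z -> f z = Order.meet (f u) (f v) &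
      forall u v z, u \in <<S>> -> v \in <<S>> -> z \in <<S>> ->
        weak_is_join S u v z -> f z = Order.join (f u) (f v)].
End Coxeter.

Section Pop.
Variables (d : Order.disp_t) (L : finLatticeType d).
Local Open Scope order_scope.

Definition covby (y x : L) : bool :=
  (y < x) && [forall z : L, ~~ ((y < z) && (z < x))].

Definition popdown (x : L) : L :=
  Order.meet x (\big[Order.meet/x]_(y : L | covby y x) y).

Definition pop_orbit (x : L) : {set L} := [set y | fconnect popdown x y].
End Pop.

(* Main.v *)
(* Lift each element of the quotient to the least element of its fibre. If x lifts
   l and x' lifts pop(l), then x' <= x s in the weak order for every right descent
   s of x: the image of x s is covered by l. The Coxeter graph of a finite group is
   a forest, hence 2-colourable; let A and B be the products of the two colour
   classes. The word ABA... with h factors represents the longest element, so it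
   contains every x as a subword, and each pop allows one to discard the last
   factor, whose letters commute. After h - 1 pops the lift is a subword of A and,
   starting with the other colour, of B, hence it is 1.

   That h alternating factors give the longest element is seen in the geometric
   representation: applying n factors to a simple root gives U_n + U_(n-1), for
   the Chebyshev polynomials U_n of the weighted adjacency matrix of the Coxeter
   graph. Since the matrix is nonnegative and the graph connected, the first time
   one root becomes negative some U_n vanishes identically, and then all roots
   become negative simultaneously; this time is the order of AB. In a forest all
   orderings of S have conjugate products, so this order is the Coxeter number. *)
Require Import Defs.
From HB Require Import structures.
From mathcomp Require Import all_boot all_order all_fingroup all_algebra.
From mathcomp Require Import cyclic ring lra zify.
From mathcomp Require Import Rstruct.
From Stdlib Require Import FunctionalExtensionality ProofIrrelevance.
From Stdlib Require Rtrigo1.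
Set Implicit Arguments. Unset Strict Implicit. Unset Printing Implicit Defensive.
Import Order.TTheory GRing.Theory Num.Theory.

Local Ltac in_gen := by repeat first
  [ assumption | exact: group1 | apply: mem_gen; by []
  | apply: groupM | rewrite groupV ].

(** * Words and length *)

Section SelfBijections.
Variable V : Type.

(** A bijection carries its inverse, so that self-bijections of a possibly infinite [V] form a group
    with an explicit inverse, as the target in [coxeter_system] requires. *)
Definition selfbij : Type :=
  {p : (V -> V) * (V -> V) | cancel p.1 p.2 /\ cancel p.2 p.1}.

Lemma selfbij_eq (p q : selfbij) : (sval p).1 =1 (sval q).1 -> p = q.
Proof.
case: p q => [[p p'] /= [pK p'K]] [[q q'] /= [qK q'K]] /= epq.
have E : p = q by apply: functional_extensionality.
subst q; have E : p' = q'.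
  by apply: functional_extensionality => v; rewrite -{1}[v]q'K pK.
by subst q'; congr exist; apply: proof_irrelevance.
Qed.

Lemma selfbij_mul_subproof (p q : selfbij) :
  let r := ((sval p).1 \o (sval q).1, (sval q).2 \o (sval p).2) in
  cancel r.1 r.2 /\ cancel r.2 r.1.
Proof.
case: p q => [[p p'] /= [pK p'K]] [[q q'] /= [qK q'K]] /=.
by split; apply: can_comp.
Qed.

Definition selfbij_mul (p q : selfbij) : selfbij :=
  exist _ (_, _) (selfbij_mul_subproof p q).
Definition selfbij_one : selfbij :=
  exist _ (id, id) (conj (fun=> erefl) (fun=> erefl)).
Definition selfbij_inv (p : selfbij) : selfbij :=
  exist _ ((sval p).2, (sval p).1) (conj (svalP p).2 (svalP p).1).
Definition selfbij_invol (g : V -> V) (gK : involutive g) : selfbij :=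
  exist _ (g, g) (conj gK gK).

End SelfBijections.

Section Words.
Local Open Scope group_scope.
Variables (gT : finGroupType) (S : {set gT}).
Hypothesis coxS : coxeter_system S.
Implicit Types (x y u v g : gT) (s t : gT) (w : seq gT).
Local Notation W := <<S>>.

(** The universal property, applied to the group of self-bijections of [V]. It yields both the sign
    character and the geometric representation. *)
Lemma coxeter_action (V : Type) (sg : gT -> V -> V) :
  (forall s, involutive (sg s)) ->
  {in S &, forall s t (v : V), iter #[s * t] (sg s \o sg t) v = v} ->
  exists rho : gT -> V -> V,
    [/\ {in W &, forall x y (v : V), rho (x * y) v = rho x (rho y v)},
        {in S, forall s (v : V), rho s v = sg s v} & forall v : V, rho 1 v = v].
Proof.
move=> sgK rel; have [_ univ] := coxS.
have mulA : associative (@selfbij_mul V) by move=> p q r; apply: selfbij_eq.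
have mul1 : left_id (@selfbij_one V) (@selfbij_mul V) by move=> p; apply: selfbij_eq.
have mulV : left_inverse (@selfbij_one V) (@selfbij_inv V) (@selfbij_mul V).
  by case=> p [pK p'K]; apply: selfbij_eq.
have [s t sS tS|phi [phiM phiS]] :=
    univ _ _ _ _ mulA mul1 mulV (fun s => selfbij_invol (sgK s)).
  apply: selfbij_eq => v /=; rewrite -[RHS](rel s t sS tS).
  by elim: #[_] => //= n ->.
exists (fun x => (sval (phi x)).1); split=> [x y Wx Wy v|s sS v|v].
- by rewrite phiM.
- by rewrite phiS.
(* The universal property does not say that [phi] preserves the unit, but [phi 1] is an idempotent
   bijection, hence the identity. *)
have := phiM 1 1 (group1 _) (group1 _); rewrite mulg1 => E.
have [_ pK] := svalP (phi 1).
have pK' := (svalP (phi 1)).1; apply: (can_inj pK').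
by have /= := congr1 (fun p => (sval p).1 v) E.
Qed.

Lemma simple_mulss s : s \in S -> s * s = 1.
Proof. by case: coxS => inv _ /inv[_]; rewrite expgS expg1. Qed.

Lemma simple_inv s : s \in S -> s^-1 = s.
Proof. by move=> sS; rewrite -[RHS]mul1g -(mulVg s) -mulgA simple_mulss ?mulg1. Qed.

Lemma simple_neq1 s : s \in S -> s != 1.
Proof. by case: coxS => inv _ /inv[]. Qed.

Lemma simpleK s : s \in S -> involutive (mulg s).
Proof. by move=> sS x; rewrite mulgA simple_mulss ?mul1g. Qed.

Lemma simpleKr s : s \in S -> involutive (mulg^~ s).
Proof. by move=> sS x; rewrite -mulgA simple_mulss ?mulg1. Qed.

Lemma simple_in s : s \in S -> s \in W. Proof. exact: mem_gen. Qed.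
Hint Resolve simple_in group1 : core.

Lemma word_prod_nil : word_prod (Nil gT) = 1. Proof. by rewrite /word_prod big_nil. Qed.
Lemma word_prod_cons s w : word_prod (s :: w) = s * word_prod w.
Proof. by rewrite /word_prod big_cons. Qed.
Lemma word_prod_cat w1 w2 : word_prod (w1 ++ w2) = word_prod w1 * word_prod w2.
Proof. by rewrite /word_prod big_cat. Qed.
Lemma word_prod_rcons w s : word_prod (rcons w s) = word_prod w * s.
Proof. by rewrite -cats1 word_prod_cat word_prod_cons word_prod_nil mulg1. Qed.

Lemma is_word_cat w1 w2 : is_word S (w1 ++ w2) = is_word S w1 && is_word S w2.
Proof. exact: all_cat. Qed.
Lemma is_word_rcons w s : is_word S (rcons w s) = (s \in S) && is_word S w.
Proof. exact: all_rcons. Qed.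

Lemma word_in w : is_word S w -> word_prod w \in W.
Proof.
elim: w => [|s w IH] /=; first by rewrite word_prod_nil group1.
case/andP=> sS /IH wW; rewrite word_prod_cons; in_gen.
Qed.

Lemma word_prod_rev w : is_word S w -> word_prod (rev w) = (word_prod w)^-1.
Proof.
elim: w => [|s w IH] /=; first by rewrite word_prod_nil invg1.
case/andP=> sS /IH E.
by rewrite rev_cons word_prod_rcons E word_prod_cons invMg (simple_inv sS).
Qed.

Lemma wordP x : x \in W -> exists2 w, is_word S w & word_prod w = x.
Proof.
case/gen_prodgP=> n [c cS ->]; exists [seq c i | i <- index_enum 'I_n].
  by apply/allP=> _ /mapP[i _ ->].
by rewrite /word_prod big_map.
Qed.

Lemma generated_ind (P : gT -> Prop) : P 1 ->
  (forall s x, s \in S -> x \in W -> P x -> P (s * x)) -> forall x, x \in W -> P x.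
Proof.
move=> P1 PM x /wordP[w wS <-].
elim: w wS => [|s w IH] /=; first by rewrite word_prod_nil.
by case/andP=> sS wS; rewrite word_prod_cons; apply: PM (IH wS); rewrite ?word_in.
Qed.

Definition has_word n x := [exists w : n.-tuple gT, is_word S w && (word_prod w == x)].

Lemma has_wordP n x :
  reflect (exists w, [/\ is_word S w, word_prod w = x & size w = n]) (has_word n x).
Proof.
apply: (iffP existsP) => [[w /andP[wS /eqP <-]]|[w [wS <- /eqP sw]]].
  by exists w; rewrite size_tuple.
by exists (Tuple sw); rewrite wS eqxx.
Qed.

Lemma len_subproof x : exists n, (x \in W) ==> has_word n x.
Proof.
case Wx: (x \in W); last by exists 0.
by have [w wS wx] := wordP Wx; exists (size w); apply/has_wordP; exists w.
Qed.

(* The value outside the group generated by [S] is irrelevant. *)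
Definition len x : nat := ex_minn (len_subproof x).

Lemma len_word x : x \in W -> exists w, [/\ is_word S w, word_prod w = x & size w = len x].
Proof. by move=> Wx; rewrite /len; case: ex_minnP => n; rewrite Wx => /has_wordP. Qed.

Lemma len_le_size w : is_word S w -> len (word_prod w) <= size w.
Proof.
move=> wS; rewrite /len; case: ex_minnP => n _; apply.
by apply/implyP=> _; apply/has_wordP; exists w.
Qed.

Lemma len1 : len 1 = 0.
Proof. by apply/eqP; rewrite -leqn0 -word_prod_nil (len_le_size (w := [::])). Qed.

Lemma len_eq0 x : x \in W -> len x = 0 -> x = 1.
Proof. by case/len_word=> w [_ <- <-] /size0nil ->; rewrite word_prod_nil. Qed.

Lemma lenM x y : x \in W -> y \in W -> len (x * y) <= len x + len y.
Proof.
move=> /len_word[u [uS <- <-]] /len_word[v [vS <- <-]].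
by rewrite -word_prod_cat -size_cat len_le_size // is_word_cat uS.
Qed.

Lemma lenV x : x \in W -> len x^-1 = len x.
Proof.
suff le y : y \in W -> len y^-1 <= len y.
  by move=> Wx; apply/eqP; rewrite eqn_leq le //= -{1}[x]invgK le ?groupV.
case/len_word=> w [wS <- <-]; rewrite -word_prod_rev // -(size_rev w) len_le_size //.
by rewrite /is_word all_rev.
Qed.

Lemma len_simple s : s \in S -> len s <= 1.
Proof.
move=> sS; have := @len_le_size [:: s].
by rewrite word_prod_cons word_prod_nil mulg1 /= sS => ->.
Qed.

(** The sign character: every generator acts on [bool] by negation, which respects the relations
    because each relator has even length. *)
Lemma odd_len_word w : is_word S w -> odd (size w) = odd (len (word_prod w)).
Proof.
have [s t _ _ v|rho [rhoM rhoS rho1]] := @coxeter_action bool (fun _ => negb) (fun _ => negbK).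
  by elim: #[_] => //= n ->; rewrite negbK.
have E (u : seq gT) : is_word S u -> rho (word_prod u) false = odd (size u).
  elim: u => [_|s u IH /= /andP[sS uS]] /=; first by rewrite word_prod_nil rho1.
  by rewrite word_prod_cons rhoM ?word_in ?(simple_in sS) // rhoS // IH.
move=> wS; have [u [uS uw <-]] := len_word (word_in wS).
by rewrite -!E // uw.
Qed.

Lemma odd_lenMs x s : x \in W -> s \in S -> odd (len (x * s)) = ~~ odd (len x).
Proof.
move=> /len_word[w [wS <- <-]] sS; rewrite -word_prod_rcons -odd_len_word ?size_rcons //.
by rewrite is_word_rcons sS.
Qed.

Definition rdesc x s := len (x * s) < len x.

Lemma len_rdesc x s : x \in W -> s \in S -> rdesc x s -> len x = (len (x * s)).+1.
Proof.
move=> Wx sS; rewrite /rdesc => lt; apply/eqP; rewrite eqn_leq lt andbT.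
have := lenM (groupM Wx (simple_in sS)) (simple_in sS).
by rewrite simpleKr // => /leq_trans->//; rewrite -addn1 leq_add2l len_simple.
Qed.

Lemma len_nrdesc x s : x \in W -> s \in S -> ~~ rdesc x s -> len (x * s) = (len x).+1.
Proof.
move=> Wx sS; rewrite /rdesc -leqNgt => le; apply/eqP; rewrite eqn_leq.
apply/andP; split.
  by apply: leq_trans (lenM Wx (simple_in sS)) _; rewrite -addn1 leq_add2l len_simple.
rewrite ltn_neqAle le andbT; apply/eqP => E.
by have := odd_lenMs Wx sS; rewrite -E; case: odd.
Qed.

Lemma rdescMs x s : x \in W -> s \in S -> rdesc (x * s) s = ~~ rdesc x s.
Proof.
move=> Wx sS; rewrite {1}/rdesc simpleKr //.
case D: (rdesc x s) => /=; last by rewrite (len_nrdesc Wx sS) ?D ?leqnn.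
by rewrite (len_rdesc Wx sS D) ltnNge leqnSn.
Qed.

Lemma rdesc_exists x : x \in W -> x != 1 -> exists2 s, s \in S & rdesc x s.
Proof.
move=> Wx x1; have [w [wS wx szw]] := len_word Wx.
case: (lastP w) wS wx szw => [|u s]; first by rewrite word_prod_nil => _ E; rewrite -E eqxx in x1.
rewrite is_word_rcons word_prod_rcons size_rcons => /andP[sS uS] ux sz.
by exists s => //; rewrite /rdesc -sz -ux simpleKr // ltnS len_le_size.
Qed.

Lemma rdescN1 s : s \in S -> ~~ rdesc 1 s.
Proof. by move=> sS; rewrite /rdesc len1. Qed.

(* [alternating s t k] is the product of [k] alternating letters ending in [t];
   [alt_letters s t k] lists first its leftmost letter for [k > 0], then the
   letter that extends it to the left. *)
Definition alt_letters s t k := if odd k then (t, s) else (s, t).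
Fixpoint alternating s t k : gT :=
  if k is k'.+1 then (alt_letters s t k').2 * alternating s t k' else 1.

Lemma alt_letters_sym s t k :
  alt_letters t s k = ((alt_letters s t k).2, (alt_letters s t k).1).
Proof. by rewrite /alt_letters; case: odd. Qed.

Lemma alt_lettersS s t k :
  alt_letters s t k.+1 = ((alt_letters s t k).2, (alt_letters s t k).1).
Proof. by rewrite /alt_letters /=; case: odd. Qed.

Lemma alt_letters_in s t k : s \in S -> t \in S ->
  ((alt_letters s t k).1 \in S) * ((alt_letters s t k).2 \in S).
Proof. by move=> sS tS; rewrite /alt_letters; case: odd => /=; rewrite sS tS. Qed.

Lemma alternatingSr s t k : alternating t s k.+1 = alternating s t k * s.
Proof.
elim: k => [|k IH]; first by rewrite /= mul1g mulg1.
rewrite [LHS]/= -/(alternating t s k.+1) IH mulgA; congr (_ * _ * _).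
by rewrite alt_letters_sym alt_lettersS.
Qed.

Lemma alternating_even s t j : alternating s t j.*2 = (s * t) ^+ j.
Proof.
elim: j => // j IH; rewrite doubleS [LHS]/= IH alt_lettersS /alt_letters.
by rewrite odd_double /= expgS mulgA.
Qed.

(** The braid relation: half of the letters of [(s t)^m = 1] are moved to the other side, with a
    case split on the parity of [m]. *)
Lemma alternating_order s t : s \in S -> t \in S ->
  alternating s t #[s * t] = alternating t s #[s * t].
Proof.
move=> sS tS; have tsV : t * s = (s * t)^-1 by rewrite invMg !simple_inv.
have := expg_order (s * t); move: #[_] => m E.
rewrite -(odd_double_half m) in E *; set j := m./2 in E *.
case: (odd m) E => /= E; rewrite /alt_letters ?odd_double ?alternating_even /=.
  rewrite tsV expgVn; apply: (mulIg ((s * t) ^+ j)).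
  rewrite -!mulgA mulVg mulg1 -expgD addnn.
  by apply: (mulgI s); rewrite simple_mulss // mulgA -expgS E.
rewrite tsV expgVn; apply: (mulIg ((s * t) ^+ j)).
by rewrite mulVg -expgD addnn.
Qed.

Lemma alternating_in s t k : s \in S -> t \in S -> alternating s t k \in W.
Proof.
move=> sS tS; elim: k => //= k IH.
have [_ yS] := alt_letters_in k sS tS; in_gen.
Qed.

Lemma len_alternating s t k : s \in S -> t \in S -> len (alternating s t k) <= k.
Proof.
move=> sS tS; elim: k => [|k IH] /=; first by rewrite len1.
have yS := (alt_letters_in k sS tS).2.
apply: leq_trans (lenM (simple_in yS) (alternating_in _ sS tS)) _.
by rewrite -add1n leq_add // len_simple.
Qed.

(* Take [k] maximal: [k < #[s * t]] because the longest element of the dihedral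
   subgroup also ends in [s]. *)
Lemma dihedral_strip x s t : x \in W -> s \in S -> t \in S -> ~~ rdesc x s ->
  exists k v, [/\ v \in W, x = v * alternating s t k, len x = len v + k &
    [/\ k < #[s * t], ~~ rdesc v s, ~~ rdesc v t & rdesc x t -> 0 < k]].
Proof.
move=> Wx sS tS Dx.
pose P k := let v := x * (alternating s t k)^-1 in len x == len v + k.
have P0 : P 0 by rewrite /P invg1 mulg1 addn0 eqxx.
have Pb k : P k -> k <= len x by rewrite /P => /eqP ->; rewrite leq_addl.
case: (ex_maxnP (ex_intro P 0 P0) Pb) => k /eqP Ek kmax.
set v := x * _ in Ek; exists k, v.
have Wp j : alternating s t j \in W by apply: alternating_in.
have Wv : v \in W by rewrite groupM ?groupV.
have Ex : x = v * alternating s t k by rewrite mulgKV.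
have [aS bS] := alt_letters_in k sS tS.
have Db : ~~ rdesc v (alt_letters s t k).2.
  apply/negP => D; suff /kmax : P k.+1 by rewrite ltnn.
  by rewrite /P /= invMg mulgA -/v (simple_inv bS) Ek (len_rdesc Wv bS D) addSnnS eqxx.
(* For [k > 0] this is the leftmost letter of the alternating word; as a descent of [v] it would
   cancel and write [x] with fewer than [len x] letters. *)
have Da : ~~ rdesc v (alt_letters s t k).1.
  case: (k) Ek Ex => [_|j Ej Exj]; first by rewrite /= mulg1 => <-.
  have cS := (alt_letters_in j sS tS).2.
  rewrite alt_lettersS /=; apply/negP => D.
  have : len x <= len (v * (alt_letters s t j).2) + j.
    rewrite {1}Exj /= mulgA; apply: leq_trans (lenM _ _) _ => //.
      in_gen.
    by rewrite leq_add2l len_alternating.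
  by rewrite Ej (len_rdesc Wv cS D); lia.
split=> //; split.
- rewrite ltnNge; apply/negP => le_mk.
  have [j Ejk] : exists j, k = j + #[s * t] by exists (k - #[s * t]); rewrite subnK.
  have : len (x * s) <= len v + k.-1.
    have -> : x * s = v * (alternating s t k * s) by rewrite Ex mulgA.
    apply: leq_trans (lenM _ _) _ => //; first in_gen.
    rewrite leq_add2l.
    have [q Wq [lq Eq]] : exists2 q, q \in W & len q <= j /\
        alternating s t k = q * alternating s t #[s * t].
      rewrite Ejk; elim: (j) => [|i [q Wq [lq Eq]]]; first by exists 1; rewrite ?len1 ?mul1g.
      have cS := (alt_letters_in (i + #[s * t]) sS tS).2.
      exists ((alt_letters s t (i + #[s * t])).2 * q); first in_gen.
      rewrite addSn [alternating _ _ _.+1]/= Eq mulgA; split=> //.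
      apply: leq_trans (lenM (simple_in cS) Wq) _.
      by rewrite -add1n leq_add ?len_simple.
    rewrite Eq alternating_order //; have := order_gt0 (s * t).
    case Em: #[s * t] => [//|m] _.
    rewrite alternatingSr mulgA simpleKr //.
    apply: leq_trans (lenM _ _) _ => //.
    by rewrite Ejk Em addnS /= leq_add // len_alternating.
  rewrite len_nrdesc // Ek.
  have : 0 < k by rewrite (leq_trans _ le_mk) ?order_gt0.
  by case: (k) => // k' _ /=; rewrite addnS ltnNge leqW.
- by move: Da Db; rewrite /alt_letters; case: odd.
- by move: Da Db; rewrite /alt_letters; case: odd.
case: (k) Ex Db => //=; rewrite mulg1 => <- Dt.
by rewrite (negPf Dt).
Qed.

End Words.

(** * The geometric representation *)

Section Chebyshev.
Local Open Scope ring_scope.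

(** The recurrence reads the same backwards, so a zero at [m] makes the sequence odd about [m]. An
    additive operator [A] covers both the scalars [chebyshev] and the vectors [frieze]. *)
Lemma recurrence_antisym (V : zmodType) (A : {additive V -> V}) (f : nat -> V) (m : nat) :
  (forall n, f n.+2 = A (f n.+1) - f n) -> f m = 0 ->
  forall j, (j <= m)%N -> f (m + j)%N = - f (m - j)%N.
Proof.
move=> rec fm; suff P j : (j.+1 <= m)%N ->
    f (m + j)%N = - f (m - j)%N /\ f (m + j.+1)%N = - f (m - j.+1)%N.
  by case=> [|j] lejm; [rewrite addn0 subn0 fm oppr0 | case: (P j lejm)].
elim: j => [|j IH] ltjm.
  rewrite addn0 subn0 fm oppr0 addn1 subn1; split=> //.
  by case: m fm ltjm => // m fm _; rewrite rec fm raddf0 sub0r.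
have [E1 E2] := IH (ltnW ltjm); split=> //.
rewrite !addnS rec -addnS E1 E2.
have [n En] : exists n, m = (n + j.+2)%N by exists (m - j.+2)%N; rewrite subnK.
have -> : (m - j = n.+2)%N by lia.
have -> : (m - j.+1 = n.+1)%N by lia.
have -> : (m - j.+2 = n)%N by lia.
by rewrite raddfN opprK rec addKr.
Qed.

Fixpoint chebyshev (R : pzRingType) (a : R) (n : nat) : R :=
  if n is n'.+1 then
    if n' is n''.+1 then a * chebyshev a n' - chebyshev a n'' else 1
  else 0.

Lemma chebyshevSS (R : pzRingType) (a : R) n :
  chebyshev a n.+2 = a * chebyshev a n.+1 - chebyshev a n.
Proof. by []. Qed.

(* [chebyshev a n] is [sin (n x) / sin x] for [a = 2 cos x], so this says
   [a = 2 cos (pi / m)]. *)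
Definition is_double_cos_pi_over (R : realFieldType) (m : nat) (a : R) : Prop :=
  chebyshev a m = 0 /\ forall j, (j <= m)%N -> 0 <= chebyshev a j.

(** Oddness about [m] carries the values at [0] and [1] to [2m] and [2m - 1]; one more step of the
    recurrence reaches [2m + 1]. *)
Lemma chebyshev_double (R : realFieldType) (m : nat) (a : R) :
  (1 < m)%N -> chebyshev a m = 0 ->
  chebyshev a m.*2 = 0 /\ chebyshev a m.*2.+1 = 1.
Proof.
move=> m1 am; have E := @recurrence_antisym R (a \*o idfun) (chebyshev a) m
  (chebyshevSS a) am.
split; first by rewrite -addnn E // subnn oppr0.
case: m m1 am E => [//|m] _ am E.
have := E m.+1 (leqnn _); rewrite subnn oppr0 addnn doubleS => E2.
have := E m (leqnSn m); rewrite addSn addnn subSn // subnn => E1.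
by rewrite chebyshevSS E2 E1 mulr0 sub0r opprK.
Qed.

Lemma double_cos_ge0 (R : realFieldType) m (a : R) :
  (1 < m)%N -> is_double_cos_pi_over m a -> 0 <= a.
Proof. by move=> m1 [_ /(_ _ m1)]; rewrite chebyshevSS mulr1 subr0. Qed.

Lemma double_cos_ge1 (R : realFieldType) m (a : R) :
  (2 < m)%N -> is_double_cos_pi_over m a -> 1 <= a.
Proof.
move=> m2 am; have a0 := double_cos_ge0 (ltnW m2) am; have [_ /(_ _ m2)] := am.
by rewrite !chebyshevSS mulr1 subr0 /=; nra.
Qed.

Lemma double_cos_2 (R : realFieldType) (a : R) : is_double_cos_pi_over 2 a -> a = 0.
Proof. by case; rewrite chebyshevSS mulr1 subr0. Qed.

(** This is the determinant of the rank two Cartan matrix. For [a = 2] the recurrence gives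
    [chebyshev a n = n], which has no zero at [m]. *)
Lemma double_cos_sqr_neq4 (R : realFieldType) m (a : R) :
  (1 < m)%N -> is_double_cos_pi_over m a -> 4 - a * a != 0.
Proof.
move=> m1 am; have a0 := double_cos_ge0 m1 am; have [am0 _] := am.
apply/eqP => E; have a2 : a = 2 by nra.
have E2 n : chebyshev a n = n%:R /\ chebyshev a n.+1 = n.+1%:R.
  elim: n => [|n [IH1 IH2]] //; split=> //.
  by rewrite chebyshevSS IH1 IH2 a2 -!natr1; ring.
by move: am0 m1; rewrite (E2 m).1 => /eqP; rewrite pnatr_eq0 => /eqP ->.
Qed.

End Chebyshev.

(** * Simple reflections and the dihedral relations *)

Section Reflections.
Local Open Scope ring_scope.
Variables (gT : finGroupType) (S : {set gT}) (R : realFieldType) (cs : nat -> R).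
Hypothesis coxS : coxeter_system S.
Hypothesis csP : forall m, (1 < m)%N -> is_double_cos_pi_over m (cs m).
Local Notation W := (<<S>>)%g.
Local Notation V := {ffun gT -> R^o}.
Implicit Types (s t x y : gT) (v : V).

(** Vectors have coordinates indexed by all of [gT]; the weight is zero as soon as one letter lies
    outside [S]. The Cartan matrix is the symmetric one, with [cs m] in the role of
    [2 cos (pi / m)]. *)
Definition edge_weight s t : R :=
  if [&& s \in S, t \in S & s != t] then cs #[s * t]%g else 0.
Definition cartan s t : R := if s == t then 2 else - edge_weight s t.
Definition simple_root s : V := [ffun t => (t == s)%:R].
Definition coroot s v : R := \sum_t cartan s t * v t.
Definition refl s v : V := v - coroot s v *: simple_root s.

Lemma order_mulgC x y : #[x * y]%g = #[y * x]%g.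
Proof. by rewrite -(orderJ (y * x)%g y) conjgE -mulgA mulKg. Qed.

Lemma edge_weight_sym s t : edge_weight s t = edge_weight t s.
Proof. by rewrite /edge_weight andbCA order_mulgC eq_sym. Qed.

Lemma cartan_sym s t : cartan s t = cartan t s.
Proof. by rewrite /cartan eq_sym edge_weight_sym. Qed.

Lemma simple_order_gt1 s t : s \in S -> t \in S -> s != t -> (1 < #[s * t]%g)%N.
Proof.
move=> sS tS; apply: contraNT; rewrite order_gt1 negbK => /eqP E.
by rewrite -(simple_inv coxS tS) eq_mulgV1 invgK E.
Qed.

Lemma edge_weight_ge0 s t : 0 <= edge_weight s t.
Proof.
rewrite /edge_weight; case: ifP => // /and3P[sS tS st].
by have m1 := simple_order_gt1 sS tS st; apply: double_cos_ge0 m1 (csP m1).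
Qed.

Lemma edge_weight_ss s : edge_weight s s = 0.
Proof. by rewrite /edge_weight eqxx !andbF. Qed.

Lemma edge_weight_ge1 s t : coxeter_graph S s t -> 1 <= edge_weight s t.
Proof.
case/and3P=> sS tS m3; rewrite /edge_weight sS tS /=.
case: eqVneq m3 => [->|st m3]; first by rewrite (simple_mulss coxS) ?order1.
by apply: double_cos_ge1 m3 (csP (ltnW m3)).
Qed.

Lemma edge_weight_eq0 s t : ~~ coxeter_graph S s t -> edge_weight s t = 0.
Proof.
rewrite /coxeter_graph /edge_weight; case: ifP => // /and3P[sS tS st].
rewrite sS tS /= -ltnNge ltnS => m2; have m1 := simple_order_gt1 sS tS st.
have E : #[s * t]%g = 2%N by apply/eqP; rewrite eqn_leq m2 m1.
by rewrite E; apply: double_cos_2; apply: csP.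
Qed.

Lemma coroot_linear s : scalar (coroot s).
Proof.
move=> c v v'; rewrite /coroot big_distrr -big_split /=.
by apply: eq_bigr => t _; rewrite !ffunE /GRing.scale /=; ring.
Qed.
HB.instance Definition _ s := GRing.isLinear.Build R V R *%R (coroot s) (coroot_linear s).

Lemma refl_linear s : linear (refl s).
Proof.
move=> c v v'; rewrite /refl linearP scalerBr scalerDl scalerA opprD addrACA.
by congr (_ + _).
Qed.
HB.instance Definition _ s := GRing.isLinear.Build R V V *:%R (refl s) (refl_linear s).

Lemma coroot_simple s t : coroot s (simple_root t) = cartan s t.
Proof.
rewrite /coroot (bigD1 t) //= ffunE eqxx mulr1 big1 ?addr0 // => u /negPf ut.
by rewrite ffunE ut mulr0.
Qed.

Lemma coroot_refl s t v : coroot s (refl t v) = coroot s v - coroot t v * cartan s t.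
Proof. by rewrite /refl linearB linearZ /= coroot_simple. Qed.

Lemma cartan_ss s : cartan s s = 2. Proof. by rewrite /cartan eqxx. Qed.

Lemma reflK s : involutive (refl s).
Proof.
move=> v; rewrite /refl -/(refl s v) coroot_refl cartan_ss /refl.
rewrite -addrA -opprD -scalerDl.
have -> : coroot s v + (coroot s v - coroot s v * 2) = 0 by ring.
by rewrite scale0r subr0.
Qed.

Lemma refl_simple s : refl s (simple_root s) = - simple_root s.
Proof. by rewrite /refl coroot_simple cartan_ss scaler_nat mulr2n opprD addrA subrr add0r. Qed.

Lemma refl_simple_neq s t : s != t ->
  refl s (simple_root t) = simple_root t + edge_weight s t *: simple_root s.
Proof. by move=> /negPf st; rewrite /refl coroot_simple /cartan st scaleNr opprK. Qed.

Lemma reflE s v t : refl s v t = if t == s then v s - coroot s v else v t.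
Proof.
rewrite !ffunE /GRing.scale /=; case: eqP => [->|_]; first by rewrite mulr1.
by rewrite mulr0 subr0.
Qed.

(** Under iteration the two coroot values evolve by Chebyshev coefficients and return after [m]
    steps. The displacement then lies in the span of the two roots and is killed by both coroots, so
    it is zero because [4 - a * a] is. *)
Lemma refl_order s t v : s \in S -> t \in S -> iter #[s * t]%g (refl s \o refl t) v = v.
Proof.
move=> sS tS; have [->|st] := eqVneq s t.
  by rewrite (simple_mulss coxS) // order1 /= reflK.
have m1 := simple_order_gt1 sS tS st; have am := csP m1.
have cst : cartan s t = - cs #[s * t]%g by rewrite /cartan /edge_weight (negPf st) sS tS.
have cts : cartan t s = - cs #[s * t]%g by rewrite cartan_sym.
have a4 := double_cos_sqr_neq4 m1 am; have [am0 _] := am.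
have [u0 u1] := chebyshev_double m1 am0.
move: cst cts a4 am0 u0 u1 {am m1}; move: (cs _) => a; move: #[_]%g => m cst cts a4 am0 u0 u1.
set g := _ \o _; set x := coroot s v; set y := coroot t v.
have Bg j : coroot t (iter j g v) = chebyshev a j.*2.+1 * y + chebyshev a j.*2 * x /\
    coroot s (iter j g v) = - (chebyshev a j.*2 * y +
                               (a * chebyshev a j.*2 - chebyshev a j.*2.+1) * x).
  elim: j => [|j [IHt IHs]]; first by rewrite /= -/x -/y; split; ring.
  have -> : iter j.+1 g v = refl s (refl t (iter j g v)) by [].
  rewrite !coroot_refl IHt IHs cst cts !cartan_ss doubleS !chebyshevSS.
  by split; ring.
have [p [q E]] : exists p q, iter m g v = v + p *: simple_root s + q *: simple_root t.
  elim: m {am0 u0 u1} => [|m [p [q E]]]; first by exists 0, 0; rewrite !scale0r !addr0.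
  rewrite iterS /g /= E /refl; set c := coroot t _; set d := coroot s _.
  exists (p - d), (q - c); apply/ffunP => z; rewrite !ffunE /GRing.scale /=; ring.
have [Et Es] := Bg m; move: Et Es; rewrite u0 u1 E !linearD !linearZ /= !coroot_simple.
rewrite cst cts !cartan_ss -/x -/y => Et Es.
(* The displacement has coefficients [p] and [q]; this is a linear system with determinant
   [4 - a * a], which is nonzero. *)
have e1 : p * 2 = q * a by lra.
have e2 : p * a = q * 2 by lra.
have p0 : p = 0.
  apply/eqP; rewrite -(mulIr_eq0 p (mulIf a4)); apply/eqP.
  have -> : p * (4 - a * a) = 2 * (p * 2) - a * (p * a) by ring.
  by rewrite e1 e2; ring.
have q0 : q = 0 by move: Et; rewrite p0; lra.
by rewrite p0 q0 !scale0r !addr0.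
Qed.

End Reflections.

(** * The real numbers [2 cos (pi / m)] *)

Section Cosine.
Local Notation R := Rdefinitions.R.
Local Notation PI := Rtrigo1.PI.
Local Notation sin := Rtrigo_def.sin.
Local Notation cos := Rtrigo_def.cos.
Local Open Scope ring_scope.
Local Arguments Rtrigo_def.sin _%_ring_scope.
Local Arguments Rtrigo_def.cos _%_ring_scope.

Lemma sin_chebyshev (x : R) n :
  chebyshev (2 * cos x) n * sin x = sin (n%:R * x) /\
  chebyshev (2 * cos x) n.+1 * sin x = sin (n.+1%:R * x).
Proof.
have s0 : sin (0 : R) = 0 by exact: Rtrigo_def.sin_0.
elim: n => [|n [IH1 IH2]].
  have E0 : 0%:R * x = 0 :> R by exact: mul0r.
  have E1 : 1%:R * x = x :> R by exact: mul1r.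
  by rewrite E0 E1 s0; split; [exact: mul0r | exact: mul1r].
split=> //; rewrite chebyshevSS mulrBl -mulrA IH1 IH2.
have -> : n.+2%:R * x = n.+1%:R * x + x :> R by rewrite -(natr1 n.+1) mulrDl mul1r.
have -> : n%:R * x = n.+1%:R * x - x :> R by rewrite -(natr1 n) mulrDl mul1r addrK.
set y := n.+1%:R * x.
have -> : sin (y + x) = sin y * cos x + cos y * sin x by exact: Rtrigo1.sin_plus.
have -> : sin (y - x) = sin y * cos x - cos y * sin x by exact: Rtrigo1.sin_minus.
by rewrite opprB addrCA [RHS]addrC; congr (_ + _); rewrite -mulrA mulr_natl mulr2n (mulrC (cos x)) addrK.
Qed.

Lemma double_cos_exists : exists cs : nat -> R,
  forall m, (1 < m)%N -> is_double_cos_pi_over m (cs m).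
Proof.
exists (fun m => 2 * cos (PI / m%:R)) => m m1.
have m0 : (0 : R) < m%:R by rewrite ltr0n; lia.
have pi0 : (0 : R) < PI by apply/RltP; exact: Rtrigo1.PI_RGT_0.
set x := PI / _.
have x0 : 0 < x by rewrite divr_gt0.
have xm : m%:R * x = PI by rewrite mulrCA mulfV ?mulr1 // gt_eqF.
have xpi : x < PI by rewrite -xm -ltr_pdivrMr // divff ?gt_eqF // ltr1n.
have sx : 0 < sin x by apply/RltP; apply: Rtrigo1.sin_gt_0; apply/RltP.
split=> [|j jm].
  have [] := sin_chebyshev x m; rewrite xm Rtrigo1.sin_PI => /eqP.
  by rewrite mulf_eq0 (gt_eqF sx) orbF => /eqP.
rewrite -(pmulr_lge0 _ sx) (sin_chebyshev x j).1; apply/RleP.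
apply: Rtrigo1.sin_ge_0; apply/RleP; first by rewrite mulr_ge0 // ltW.
by rewrite -xm ler_pM2r // ler_nat.
Qed.

End Cosine.

(** * Alternating layers of a 2-colouring *)

Section Layers.
Local Open Scope group_scope.
Variables (gT : finGroupType) (S : {set gT}) (col : gT -> bool).
Hypothesis coxS : coxeter_system S.
Hypothesis colP : forall s t, coxeter_graph S s t -> col s != col t.

Definition layer (b : bool) : seq gT := [seq s <- enum S | col s == b].

Lemma mem_layer b s : (s \in layer b) = (s \in S) && (col s == b).
Proof. by rewrite mem_filter mem_enum andbC. Qed.

Lemma layer_uniq b : uniq (layer b).
Proof. by rewrite filter_uniq // enum_uniq. Qed.

Lemma layer_word b : is_word S (layer b).
Proof. by apply/allP => s; rewrite mem_layer => /andP[]. Qed.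

Lemma layer_nonadjacent b : {in layer b &, forall s t, ~~ coxeter_graph S s t}.
Proof.
move=> s t; rewrite !mem_layer => /andP[_ /eqP cs] /andP[_ /eqP ct].
by apply/negP => /colP; rewrite cs ct eqxx.
Qed.

(* The word of [n] alternating layers whose last layer is [~~ b]. *)
Fixpoint layers b n : seq gT :=
  if n is n'.+1 then layer (b (+) odd n) ++ layers b n' else [::].

Lemma layersS b n : layers b n.+1 = layer (b (+) odd n.+1) ++ layers b n.
Proof. by []. Qed.

Lemma layersSr b n : layers b n.+1 = layers (~~ b) n ++ layer (~~ b).
Proof.
elim: n => [|n IH]; first by rewrite /= addbT cats0.
by rewrite layersS IH layersS catA /= addNb -addbN.
Qed.

Lemma layers_word b n : is_word S (layers b n).
Proof. by elim: n => //= n IH; rewrite is_word_cat layer_word. Qed.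

Local Notation L b := (word_prod (layer b)).
Local Notation lay b n := (word_prod (layers b n)).

Lemma lay_double b n : lay b n.*2 = (L b * L (~~ b)) ^+ n.
Proof.
elim: n => [|n IH]; first by rewrite word_prod_nil.
by rewrite doubleS /= !word_prod_cat IH expgS mulgA odd_double addbT addbF.
Qed.

End Layers.

(** * Positive roots, descents and the order of alternating layers *)

Section Roots.
Local Open Scope ring_scope.
Variables (gT : finGroupType) (S : {set gT}) (R : realFieldType) (cs : nat -> R).
Hypothesis coxS : coxeter_system S.
Hypothesis csP : forall m, (1 < m)%N -> is_double_cos_pi_over m (cs m).
Local Notation W := (<<S>>)%g.
Local Notation V := {ffun gT -> R^o}.
Local Notation root := (@simple_root gT R).
Local Notation refl := (refl S cs).
Local Notation len := (len S).
Local Notation rdesc := (rdesc S).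
Local Notation ew := (edge_weight S cs).
Variable rho : gT -> V -> V.
Hypothesis rhoM : {in W &, forall x y v, rho (x * y)%g v = rho x (rho y v)}.
Hypothesis rhoS : {in S, forall s v, rho s v = refl s v}.
Hypothesis rho1 : forall v, rho 1%g v = v.
Implicit Types (s t x y : gT) (v : V) (w : seq gT).

Lemma rho_simpleM s x v : s \in S -> x \in W -> rho (s * x)%g v = refl s (rho x v).
Proof. by move=> sS Wx; rewrite rhoM ?(mem_gen sS) // rhoS. Qed.

Lemma rhoM_simple x s v : x \in W -> s \in S -> rho (x * s)%g v = rho x (refl s v).
Proof. by move=> Wx sS; rewrite rhoM ?(mem_gen sS) // (rhoS sS). Qed.

Lemma rho_linear x : x \in W -> linear (rho x).
Proof.
elim/(@generated_ind gT S) => {x} [|s x sS Wx IH] c v v'; first by rewrite !rho1.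
by rewrite !rho_simpleM // IH linearP.
Qed.

Lemma rhoZ x c v : x \in W -> rho x (c *: v) = c *: rho x v.
Proof.
move=> Wx; have /(_ c v 0) := rho_linear Wx; have /(_ (-1) 0 0) := rho_linear Wx.
by rewrite !addr0 !scaleN1r oppr0 addNr => ->; rewrite addr0.
Qed.

Lemma rhoD x v v' : x \in W -> rho x (v + v') = rho x v + rho x v'.
Proof. by move=> Wx; have /(_ 1 v v') := rho_linear Wx; rewrite !scale1r. Qed.

Lemma rhoN x v : x \in W -> rho x (- v) = - rho x v.
Proof. by move=> Wx; rewrite -scaleN1r rhoZ // scaleN1r. Qed.

Lemma rhoK x : x \in W -> cancel (rho x) (rho x^-1%g).
Proof. by move=> Wx v; rewrite -rhoM ?groupV // mulVg rho1. Qed.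

Lemma rho_ss x s : x \in W -> s \in S ->
  rho (x * s)%g (root s) = - rho x (root s).
Proof. by move=> Wx sS; rewrite rhoM_simple // refl_simple rhoN. Qed.

Definition nonneg v := forall t, 0 <= v t.

Lemma nonnegD v v' : nonneg v -> nonneg v' -> nonneg (v + v').
Proof. by move=> v0 v0' t; rewrite ffunE addr_ge0. Qed.

Lemma nonnegZ c v : 0 <= c -> nonneg v -> nonneg (c *: v).
Proof. by move=> c0 v0 t; rewrite ffunE mulr_ge0. Qed.

Lemma nonneg_simple s : nonneg (root s).
Proof. by move=> t; rewrite ffunE ler0n. Qed.

Lemma nonneg_anti v : nonneg v -> nonneg (- v) -> v = 0.
Proof.
move=> v0 v1; apply/ffunP => t; rewrite ffunE; apply/eqP.
by rewrite eq_le v0 andbT -oppr_ge0; have := v1 t; rewrite ffunE.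
Qed.

Lemma rho_alternating s t k : s \in S -> t \in S -> s != t ->
  rho (alternating s t k) (root s) =
    chebyshev (edge_weight S cs s t) k.+1 *: root (alt_letters s t k).1 +
    chebyshev (edge_weight S cs s t) k *: root (alt_letters s t k).2.
Proof.
move=> sS tS st; elim: k => [|k IH]; first by rewrite /= rho1 scale1r scale0r addr0.
have [aS bS] := alt_letters_in k sS tS.
rewrite [alternating _ _ _]/= rho_simpleM ?alternating_in // IH.
rewrite linearD !linearZ /= refl_simple alt_lettersS /=.
have ab : (alt_letters s t k).2 != (alt_letters s t k).1.
  by rewrite /alt_letters; case: odd => //; rewrite eq_sym.
have wab : edge_weight S cs (alt_letters s t k).2 (alt_letters s t k).1
    = edge_weight S cs s t.
  by rewrite /alt_letters; case: odd => //; rewrite edge_weight_sym.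
rewrite refl_simple_neq // wab -/(chebyshev _ k.+2) chebyshevSS.
by apply/ffunP => z; rewrite !ffunE /GRing.scale /=; ring.
Qed.

(** The alternating word sends [root s] to a combination of the two roots with Chebyshev
    coefficients of index [k] and [k.+1], both nonnegative because [k < m]. *)
Lemma nonneg_alternating x s t k : x \in W -> s \in S -> t \in S -> s != t ->
  (k < #[s * t]%g)%N -> nonneg (rho x (root s)) -> nonneg (rho x (root t)) ->
  nonneg (rho (x * alternating s t k)%g (root s)).
Proof.
move=> Wx sS tS st km xs xt.
have [_ u0] : is_double_cos_pi_over #[s * t]%g (edge_weight S cs s t).
  by rewrite /edge_weight sS tS st; apply/csP/(simple_order_gt1 coxS).
rewrite rhoM ?alternating_in // rho_alternating // rhoD // !rhoZ //.
apply: nonnegD; apply: nonnegZ; rewrite ?u0 ?(ltnW km) //.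
all: by rewrite /alt_letters; case: odd.
Qed.

(** Induction on length: for a descent [t] of [x], [dihedral_strip] splits off an alternating word
    in [s] and [t], leaving a shorter [v] with neither letter as a descent. *)
Lemma nrdesc_nonneg x s : x \in W -> s \in S -> ~~ rdesc x s -> nonneg (rho x (root s)).
Proof.
have [n] := ubnP (len x); elim: n x s => // n IH x s le_n Wx sS Ds.
have [->|x1] := eqVneq x 1%g; first by rewrite rho1; apply: nonneg_simple.
have [t tS Dt] := rdesc_exists coxS Wx x1.
have st : s != t by apply: contraNneq Ds => ->.
have [k [v [Wv Ex lx [km vs vt /(_ Dt) k0]]]] := dihedral_strip coxS Wx sS tS Ds.
rewrite Ex; apply: nonneg_alternating => //; apply: IH => //; lia.
Qed.

Lemma rdesc_nonpos x s : x \in W -> s \in S -> rdesc x s -> nonneg (- rho x (root s)).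
Proof.
move=> Wx sS D; rewrite -rho_ss //; apply: nrdesc_nonneg => //; first in_gen.
by rewrite rdescMs // D.
Qed.

Lemma rho_simple_neq0 x s : x \in W -> rho x (root s) <> 0.
Proof.
move=> Wx E; have := rhoK Wx (root s); rewrite E -[0](scale0r 0) rhoZ ?groupV // scale0r.
by move/ffunP/(_ s); rewrite !ffunE eqxx => /esym/eqP; rewrite oner_eq0.
Qed.

Lemma rdescP x s : x \in W -> s \in S -> rdesc x s <-> nonneg (- rho x (root s)).
Proof.
move=> Wx sS; split=> [|neg]; first exact: rdesc_nonpos.
case D: (rdesc x s) => //; case: (@rho_simple_neq0 x s Wx).
by apply: nonneg_anti => //; apply: nrdesc_nonneg; rewrite ?D.
Qed.

Lemma nrdescP x s : x \in W -> s \in S -> ~~ rdesc x s <-> nonneg (rho x (root s)).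
Proof.
move=> Wx sS; split=> [|pos]; first exact: nrdesc_nonneg.
apply/negP => /rdesc_nonpos neg; case: (@rho_simple_neq0 x s Wx).
by apply: nonneg_anti => //; apply: neg.
Qed.

Lemma rho_faithful x : x \in W -> (forall s, s \in S -> rho x (root s) = root s) -> x = 1%g.
Proof.
move=> Wx E; apply/eqP; apply: contraT => /(rdesc_exists coxS Wx)[s sS].
have : ~~ rdesc x s by apply/nrdescP; rewrite ?E //; apply: nonneg_simple.
by move/negPf->.
Qed.

Lemma rdesc_commute x s t : x \in W -> s \in S -> t \in S -> s != t ->
  ~~ coxeter_graph S s t -> rdesc (x * s)%g t = rdesc x t.
Proof.
move=> Wx sS tS st nadj.
have E : rho (x * s)%g (root t) = rho x (root t).
  rewrite rhoM_simple // refl_simple_neq //.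
  by rewrite (edge_weight_eq0 coxS csP) // scale0r addr0.
have Wxs : (x * s)%g \in W by in_gen.
by apply/idP/idP => D; apply/rdescP => //; [rewrite -E|rewrite E]; apply/rdescP.
Qed.

(** Strip the dihedral part of [x s] and put [s] back. If the resulting alternating word had fewer
    than [#[s * t]] letters, [x] would keep [root t] positive, although [t] is a descent. *)
Lemma rdesc_pair x s t : x \in W -> s \in S -> t \in S -> s != t ->
  rdesc x s -> rdesc x t ->
  exists2 v, v \in W & x = (v * alternating s t #[s * t])%g /\ len x = (len v + #[s * t]%g)%N.
Proof.
move=> Wx sS tS st Ds Dt.
have Ds' : ~~ rdesc (x * s)%g s by rewrite rdescMs // Ds.
have Wxs : (x * s)%g \in W by in_gen.
have [k [v [Wv Ex lx [km vs vt _]]]] := dihedral_strip coxS Wxs sS tS Ds'.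
have Ex' : x = (v * alternating t s k.+1)%g.
  by rewrite alternatingSr mulgA -Ex (simpleKr coxS sS).
have lx' : len x = (len v + k.+1)%N by rewrite (len_rdesc coxS Wx sS Ds) lx addnS.
have [kE|km'] := ltnP k.+1 #[s * t]%g; last first.
  have kE : k.+1 = #[s * t]%g by apply/eqP; rewrite eqn_leq km km'.
  by exists v => //; rewrite (alternating_order coxS) // -kE.
have : ~~ rdesc x t; last by rewrite Dt.
apply/nrdescP => //; rewrite Ex'; apply: nonneg_alternating => //; try exact/nrdescP.
- by rewrite eq_sym.
- by rewrite order_mulgC.
Qed.

Definition form v v' : R := \sum_t v t * coroot S cs t v'.

Lemma form_sym v v' : form v v' = form v' v.
Proof.
rewrite /form /coroot.
under eq_bigr do rewrite big_distrr /=.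
rewrite exchange_big /=; apply: eq_bigr => t _; rewrite big_distrr /=.
by apply: eq_bigr => u _; rewrite (cartan_sym S cs u t); ring.
Qed.

Lemma form_simple s v : form (root s) v = coroot S cs s v.
Proof.
rewrite /form (bigD1 s) //= ffunE eqxx mul1r big1 ?addr0 // => u /negPf us.
by rewrite ffunE us mul0r.
Qed.

Lemma formBZ v v' c u : form (v - c *: v') u = form v u - c * form v' u.
Proof.
rewrite /form mulr_sumr -sumrB; apply: eq_bigr => t _.
by rewrite !ffunE /GRing.scale /=; ring.
Qed.

Lemma form_refl s v v' : form (refl s v) (refl s v') = form v v'.
Proof.
rewrite /refl formBZ form_simple ![form v _]form_sym formBZ !form_simple.
rewrite -/(refl s v') coroot_refl cartan_ss (form_sym v' v); ring.
Qed.

Lemma form_rho x v v' : x \in W -> form (rho x v) (rho x v') = form v v'.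
Proof.
elim/(@generated_ind gT S) => {x} [|s x sS Wx IH]; first by rewrite !rho1.
by rewrite !rho_simpleM // form_refl.
Qed.

(* A positive root made negative by the simple reflection [a] is supported at
   [a], and the invariant form fixes its scale. *)
Lemma rdesc_lift x a s : x \in W -> a \in S -> s \in S ->
  ~~ rdesc x s -> rdesc (a * x)%g s -> (a * x)%g = (x * s)%g.
Proof.
move=> Wx aS sS Dx Dax; have Wax : (a * x)%g \in W by in_gen.
have /nrdescP pos := Dx; have /rdescP neg := Dax.
set v := rho x (root s) in pos.
have Eax : rho (a * x)%g (root s) = refl a v by rewrite rho_simpleM.
have vE : v = v a *: root a.
  apply/ffunP => t; rewrite !ffunE /GRing.scale /=; case: eqP => [->|/eqP ta]; first by rewrite mulr1.
  rewrite mulr0; apply/eqP; rewrite eq_le pos // andbT -oppr_ge0.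
  by have := neg Wax sS t; rewrite Eax ffunE reflE (negPf ta).
have va1 : v a = 1.
  have E c (u : V) : form (c *: u) (c *: u) = c * c * form u u.
    rewrite /form mulr_sumr; apply: eq_bigr => t _.
    by rewrite linearZ /= ffunE /GRing.scale /=; ring.
  have := form_rho (root s) (root s) Wx; have := pos Wx sS a; rewrite -/v.
  move: (v a) vE => c ->; rewrite E !form_simple !coroot_simple !cartan_ss; nra.
have {}vE : v = root a by rewrite vE va1 scale1r.
(* Since [rho x] sends [root s] to [root a] and preserves the form, it conjugates [refl s] into
   [refl a]; hence [x^-1 a x s] acts trivially. *)
have -> : (a * x = x * (x^-1 * (a * x)))%g by rewrite mulKVg.
congr (x * _)%g; apply: (can_inj (simpleKr coxS sS)); rewrite (simple_mulss coxS sS).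
apply: rho_faithful => [|t tS]; first in_gen.
have Wxa : (x^-1 * (a * x) \in W)%g by in_gen.
rewrite rhoM_simple // rhoM ?groupV // rho_simpleM //.
rewrite {1}/refl rhoD ?groupV // rhoN ?groupV // rhoZ ?groupV // rhoK // -vE rhoK //.
set z := refl s (root t).
have -> : coroot S cs a (rho x z) = coroot S cs s z.
  by rewrite -form_simple -vE form_rho // form_simple.
by rewrite -/(refl s z) reflK.
Qed.

Lemma rho_sum x (I : finType) (P : pred I) (F : I -> V) : x \in W ->
  rho x (\sum_(i | P i) F i) = \sum_(i | P i) rho x (F i).
Proof.
move=> Wx; apply: (big_morph (rho x)) => [v v'|]; first exact: rhoD.
by rewrite -(scale0r (0 : V)) rhoZ // !scale0r.
Qed.

(** The terms at [x] and [x s] are opposite. *)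
Lemma sum_rho_simple s : s \in S -> \sum_(x in W) rho x (root s) = 0.
Proof.
move=> sS; set v := \sum_(x in W) _.
have E : v = - v.
  rewrite {1}/v (reindex_inj (mulIg s)) /= -sumrN.
  apply: eq_big => [x|x]; rewrite (groupMr _ (mem_gen sS)) // => Wx.
  by rewrite rho_ss.
by apply/ffunP => t; have := congr1 (fun f : V => f t) E; rewrite !ffunE; lra.
Qed.

(** Appending an ascending letter [s] to [y] adds a nonnegative multiple of the positive root
    [rho y (root s)]. *)
Lemma rho_antidominant v x : x \in W -> (forall s, s \in S -> coroot S cs s v <= 0) ->
  nonneg (rho x v - v).
Proof.
move=> Wx v0; have [n] := ubnP (len x); elim: n x Wx => // n IH x Wx le_n.
have [->|x1] := eqVneq x 1%g; first by rewrite rho1 subrr => t; rewrite ffunE.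
have [s sS D] := rdesc_exists coxS Wx x1.
have Wy : (x * s)%g \in W by in_gen.
have Dy : ~~ rdesc (x * s)%g s by rewrite rdescMs // D.
rewrite -[x](simpleKr coxS sS) rhoM_simple // /refl rhoD // rhoN // rhoZ // addrAC.
apply: nonnegD; first by apply: IH => //; rewrite -ltnS; apply: leq_trans le_n.
by rewrite -scaleNr; apply: nonnegZ; rewrite ?oppr_ge0 ?v0 //; apply: nrdesc_nonneg.
Qed.

(* If every vertex of [T] had two neighbours in [T], the sum of the simple roots
   of [T] would be antidominant, hence minimal in its orbit, whereas orbits sum
   to zero. *)
Lemma coxeter_graph_sparse (T : {set gT}) : T \subset S -> T != set0 ->
  exists2 t, t \in T & (#|[set u in T | coxeter_graph S t u]| <= 1)%N.
Proof.
move=> TS /set0Pn[t0 Tt0]; apply/exists_inP; apply: contraT; rewrite negb_exists_in.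
move/forall_inP => deg; pose d : V := \sum_(t in T) root t.
have dE t : d t = (t \in T)%:R.
  rewrite /d sum_ffunE; have [Tt|nTt] := boolP (t \in T).
    rewrite (bigD1 t) //= ffunE eqxx big1 ?addr0 // => u /andP[_ /negPf ut].
    by rewrite ffunE eq_sym ut.
  by rewrite big1 // => u Tu; rewrite ffunE; case: eqP => // tu; rewrite tu Tu in nTt.
have d0 s : s \in S -> coroot S cs s d <= 0.
  move=> sS; rewrite /d linear_sum /=; under eq_bigr do rewrite coroot_simple.
  have [Ts|nTs] := boolP (s \in T); last first.
    rewrite -oppr_ge0 -sumrN; apply: sumr_ge0 => t Tt; rewrite /cartan.
    case: eqP => [E|_]; first by rewrite -E (negPf nTs) in Tt.
    by rewrite opprK (edge_weight_ge0 coxS csP).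
  rewrite (bigD1 s) //= cartan_ss.
  have -> : \sum_(t in T | t != s) cartan S cs s t = - \sum_(t in T | t != s) ew s t.
    rewrite -sumrN; apply: eq_bigr => t /andP[_ /negPf ts].
    by rewrite /cartan eq_sym ts.
  rewrite subr_le0.
  (* At least two neighbours, each of weight at least [1], outweigh the diagonal entry [2]. *)
  have := deg s Ts; rewrite -ltnNge => deg2.
  apply: (@le_trans _ _ (\sum_(t in [set u in T | coxeter_graph S s u]) 1)).
    by rewrite sumr_const ler_nat.
  rewrite [leRHS](bigID (coxeter_graph S s)) /= -[leLHS]addr0; apply: lerD; last first.
    by apply: sumr_ge0 => t _; apply: edge_weight_ge0.
  rewrite (eq_bigl (fun t => [&& t \in T, t != s & coxeter_graph S s t])); last first.
    move=> t; rewrite inE; case: (t \in T) => //=; case: eqP => //= ->.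
    by rewrite /coxeter_graph (simple_mulss coxS sS) order1 !andbF.
  rewrite [leRHS](eq_bigl (fun t => [&& t \in T, t != s & coxeter_graph S s t])); last first.
    by move=> t; rewrite andbA.
  by apply: ler_sum => t /and3P[_ _ ?]; apply: edge_weight_ge1.
have : \sum_(x in W) rho x d = 0.
  under eq_bigr => x Wx do rewrite /d rho_sum //.
  rewrite exchange_big big1 //= => t Tt.
  by apply: sum_rho_simple; apply: (subsetP TS).
(* At the coordinate [t0] every summand is at least [d t0 = 1], so the sum cannot vanish. *)
move/(congr1 (fun f : V => f t0)); rewrite sum_ffunE ffunE (bigD1 1%g) ?group1 //= rho1 dE Tt0.
move=> E; suff : (0 : R) < 0 by rewrite ltxx.
rewrite -{2}E; apply: (lt_le_trans ltr01); rewrite lerDl; apply: sumr_ge0 => x /andP[Wx _].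
have := rho_antidominant Wx d0 t0; rewrite !ffunE dE Tt0 subr_ge0.
exact: le_trans.
Qed.

Lemma rho_outside x v t : x \in W -> t \notin S -> rho x v t = v t.
Proof.
move=> Wx nt; elim/(@generated_ind gT S): Wx => [|s y sS Wy IH]; first by rewrite rho1.
by rewrite rho_simpleM // reflE; case: eqP => // E; rewrite -E (negPf nt) in sS.
Qed.

(** The positive root [rho y (root s)] is a nonnegative combination of simple roots of [S], and [p]
    makes each of these negative. *)
Lemma rdesc_longest p y s : p \in W -> y \in W -> s \in S ->
  (forall t, t \in S -> rdesc p t) -> ~~ rdesc y s -> rdesc (p * y)%g s.
Proof.
move=> Wp Wy sS desc /nrdescP pos; apply/rdescP => //; first in_gen.
rewrite rhoM //; set v := rho y (root s) in pos *.
have -> : v = \sum_(t in S) v t *: root t.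
  apply/ffunP => u; rewrite sum_ffunE.
  have [uS|nuS] := boolP (u \in S).
    rewrite (bigD1 u) //= !ffunE eqxx /GRing.scale /= mulr1 big1 ?addr0 // => t /andP[_ /negPf tu].
    by rewrite !ffunE /GRing.scale /= eq_sym tu mulr0.
  rewrite big1 => [|t tS].
    by rewrite /v rho_outside // ffunE; case: eqP => // E; rewrite E sS in nuS.
  rewrite !ffunE /GRing.scale /=; case: eqP => [E|_]; last by rewrite mulr0.
  by rewrite E tS in nuS.
rewrite rho_sum // -sumrN => r; rewrite sum_ffunE; apply: sumr_ge0 => t tS.
rewrite rhoZ // -scalerN ffunE; apply: mulr_ge0; first exact: pos.
by have /rdescP -> := desc t tS.
Qed.

Variable col : gT -> bool.
Hypothesis colP : forall s t, coxeter_graph S s t -> col s != col t.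

Definition adjacency v : V := [ffun s => \sum_t ew s t * v t].

Lemma adjacency_linear : linear adjacency.
Proof.
move=> c v v'; apply/ffunP => s; rewrite !ffunE /GRing.scale /= mulr_sumr -big_split /=.
by apply: eq_bigr => t _; rewrite !ffunE /GRing.scale /=; ring.
Qed.
HB.instance Definition _ := GRing.isLinear.Build R V V *:%R adjacency adjacency_linear.

Lemma corootE s v : coroot S cs s v = 2 * v s - adjacency v s.
Proof.
rewrite /coroot ffunE (bigD1 s) //= cartan_ss [in RHS](bigD1 s) //= edge_weight_ss.
have -> : \sum_(t | t != s) cartan S cs s t * v t = - \sum_(t | t != s) ew s t * v t.
  by rewrite -sumrN; apply: eq_bigr => t /negPf ts; rewrite /cartan eq_sym ts mulNr.
by congr (_ - _); rewrite mul0r add0r.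
Qed.

(** Pairwise nonadjacent reflections act simultaneously: the coordinates already changed have weight
    zero towards the next letter. *)
Lemma rho_nonadjacent w v t : is_word S w -> uniq w ->
  {in w &, forall s u, ~~ coxeter_graph S s u} ->
  rho (word_prod w) v t = if t \in w then adjacency v t - v t else v t.
Proof.
elim: w t => [|s w IH] t; first by rewrite word_prod_nil rho1.
move=> /= /andP[sS wS] /andP[sw wu] nadj.
have {}IH z : rho (word_prod w) v z = if z \in w then adjacency v z - v z else v z.
  by apply: IH => // a b aw bw; apply: nadj; rewrite inE ?aw ?bw orbT.
rewrite word_prod_cons rho_simpleM ?word_in // reflE corootE inE.
case: eqP => [->|_] /=; last exact: IH.
have -> (c d : R) : c - (2 * c - d) = d - c by ring.
rewrite IH (negPf sw); congr (_ - _).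
rewrite !ffunE; apply: eq_bigr => u _; rewrite IH; case: ifP => // uw.
by rewrite (edge_weight_eq0 coxS csP) ?mul0r // nadj ?mem_head ?inE ?uw ?orbT.
Qed.

Definition colored (b : bool) v := forall t, ~~ ((t \in S) && (col t == b)) -> v t = 0.

Lemma adjacency_colored b v : colored b v -> colored (~~ b) (adjacency v).
Proof.
move=> vb t nt; rewrite ffunE big1 // => u _.
have [tu|/(edge_weight_eq0 coxS csP)->] := boolP (coxeter_graph S t u); last by rewrite mul0r.
rewrite vb ?mulr0 //; apply: contra nt => /andP[uS /eqP <-].
by have /and3P[-> _ _] := tu; have := colP tu; case: (col t); case: (col u).
Qed.

Lemma coloredB b v v' : colored b v -> colored b v' -> colored b (v - v').
Proof. by move=> vb vb' t nt; rewrite !ffunE vb // vb' // subrr. Qed.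

Lemma coloredN b v t : colored b v -> (t \in S) && (col t == ~~ b) -> v t = 0.
Proof. by move=> vb /andP[_ /eqP ct]; apply: vb; rewrite ct; case: (b); rewrite andbF. Qed.

Lemma colored_simple s : s \in S -> colored (col s) (root s).
Proof. by move=> sS t; rewrite ffunE; case: (t =P s) => // ->; rewrite sS eqxx. Qed.

Local Notation L b := (word_prod (layer S col b)).
Local Notation lay b n := (word_prod (layers S col b n)).

Lemma rho_layer b v t :
  rho (L b) v t = if (t \in S) && (col t == b) then adjacency v t - v t else v t.
Proof.
by rewrite rho_nonadjacent ?mem_layer ?layer_word ?layer_uniq //; apply: layer_nonadjacent.
Qed.

Lemma layer_same b v : colored b v -> rho (L b) v = - v.
Proof.
move=> vb; apply/ffunP => t; rewrite rho_layer !ffunE; case: ifP => [Ht|/negbT/vb->]; last by rewrite oppr0.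
have := adjacency_colored vb; move/coloredN => /(_ t); rewrite negbK ffunE => -> //.
by rewrite sub0r.
Qed.

Lemma layer_opp b v : colored (~~ b) v -> rho (L b) v = v + adjacency v.
Proof.
move=> vb; apply/ffunP => t; rewrite rho_layer [RHS]ffunE.
have := adjacency_colored vb; rewrite negbK => Avb; case: ifP => [Ht|/negbT/Avb->]; last by rewrite addr0.
by rewrite (_ : v t = 0) ?subr0 ?add0r //; apply: (coloredN vb); rewrite negbK.
Qed.

Lemma layer_inv b : (L b)^-1%g = L b.
Proof.
have WL : L b \in W by rewrite word_in ?layer_word.
apply/eqP; rewrite eq_invg_mul; apply/eqP; apply: rho_faithful => [|s sS].
  by rewrite groupM.
have c := colored_simple sS; rewrite rhoM //; have [Eb|nb] := eqVneq b (col s).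
  by rewrite -Eb in c; rewrite (layer_same c) rhoN // (layer_same c) opprK.
have Ec : col s = ~~ b by case: (b) (col s) nb => [] [].
rewrite Ec in c; have := adjacency_colored c; rewrite negbK => Ac.
by rewrite (layer_opp c) rhoD // (layer_opp c) (layer_same Ac) addrK.
Qed.

(** This is [chebyshev] evaluated at the operator [adjacency] and applied to [v], defined directly
    on vectors. *)
Fixpoint frieze (n : nat) v : V :=
  if n is n'.+1 then
    if n' is n''.+1 then adjacency (frieze n' v) - frieze n'' v else v
  else 0.

Lemma friezeSS n v : frieze n.+2 v = adjacency (frieze n.+1 v) - frieze n v.
Proof. by []. Qed.

Lemma frieze_colored n b v : colored b v -> colored (b (+) ~~ odd n) (frieze n v).
Proof.
move=> vb; suff [] : colored (b (+) ~~ odd n) (frieze n v) /\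
    colored (b (+) odd n) (frieze n.+1 v) by [].
elim: n => [|n [IH1 IH2]]; first by rewrite addbF; split=> // t _; rewrite ffunE.
split; first by rewrite /= negbK.
rewrite friezeSS; apply: coloredB; last by [].
by have := adjacency_colored IH2; rewrite -addbN.
Qed.

Lemma frieze_linear n : linear (frieze n).
Proof.
suff [] : linear (frieze n) /\ linear (frieze n.+1) by [].
elim: n => [|n [IH1 IH2]]; first by split=> c v v' //=; rewrite scaler0 addr0.
split=> // c v v'; rewrite !friezeSS IH1 IH2 linearP scalerBr opprD addrACA.
by [].
Qed.
HB.instance Definition _ n := GRing.isLinear.Build R V V *:%R (frieze n) (frieze_linear n).

Lemma frieze_adjacency n v : frieze n (adjacency v) = adjacency (frieze n v).
Proof.
suff [] : frieze n (adjacency v) = adjacency (frieze n v) /\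
    frieze n.+1 (adjacency v) = adjacency (frieze n.+1 v) by [].
elim: n => [|n [IH1 IH2]]; first by rewrite linear0.
by split=> //; rewrite !friezeSS IH1 IH2 linearB.
Qed.

(** The two summands live on opposite colours. The next layer negates [frieze n] and adds to
    [frieze n.+1] its image under [adjacency], which is the recurrence. *)
Lemma rho_layers n s : s \in S ->
  rho (lay (col s) n) (root s) = frieze n.+1 (root s) + frieze n (root s).
Proof.
move=> sS; have cs0 := colored_simple sS.
elim: n => [|n IH]; first by rewrite word_prod_nil rho1 addr0.
rewrite [layers _ _ _ _]/= word_prod_cat rhoM ?word_in ?layer_word ?layers_word //.
rewrite IH rhoD ?word_in ?layer_word //.
have := @frieze_colored n.+1 _ _ cs0; have := @frieze_colored n _ _ cs0.
rewrite /= negbK => c1 c2; rewrite (layer_same c1) layer_opp; last by rewrite addbN negbK.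
by rewrite -addrA addrC.
Qed.

(** Opposite colours mean disjoint supports, so signs are read off separately. *)
Lemma nonneg_frieze n s : s \in S -> nonneg (frieze n.+1 (root s) + frieze n (root s)) ->
  nonneg (frieze n.+1 (root s)) /\ nonneg (frieze n (root s)).
Proof.
move=> sS pos; have cs0 := colored_simple sS.
have := @frieze_colored n.+1 _ _ cs0; have := @frieze_colored n _ _ cs0.
rewrite [odd n.+1]/= negbK => c1 c2; split=> t; have := pos t; rewrite ffunE.
  have [Ht|/c2->//] := boolP ((t \in S) && (col t == col s (+) odd n)).
  by rewrite (coloredN c1) ?addr0 // addbN negbK.
have [Ht|/c1->//] := boolP ((t \in S) && (col t == col s (+) ~~ odd n)).
by rewrite (coloredN c2) ?add0r // -addbN.
Qed.

Lemma adjacency_simple s : adjacency (root s) = \sum_t ew t s *: root t.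
Proof.
apply/ffunP => u; rewrite ffunE sum_ffunE (bigD1 s) //= ffunE eqxx mulr1 big1 ?addr0.
  rewrite (bigD1 u) //= !ffunE eqxx /GRing.scale /= mulr1 big1 ?addr0 // => t /negPf tu.
  by rewrite !ffunE /GRing.scale /= eq_sym tu mulr0.
by move=> t /negPf ts; rewrite ffunE ts mulr0.
Qed.

Lemma coxeter_graph_sym s t : coxeter_graph S s t = coxeter_graph S t s.
Proof. by rewrite /coxeter_graph andbCA order_mulgC. Qed.

(* [frieze k] commutes with [adjacency], so its vanishing propagates along edges. *)
Lemma frieze_eq0 k s0 : irreducible_coxeter S -> s0 \in S ->
  (forall s, s \in S -> nonneg (frieze k (root s))) -> frieze k (root s0) = 0 ->
  forall t, t \in S -> frieze k (root t) = 0.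
Proof.
move=> [_ conn] s0S pos z0 t tS.
have step s u : coxeter_graph S s u -> frieze k (root s) = 0 -> frieze k (root u) = 0.
  move=> su z; have /and3P[sS uS _] := su.
  have : frieze k (adjacency (root s)) = 0 by rewrite frieze_adjacency z linear0.
  rewrite adjacency_simple linear_sum => E; apply: nonneg_anti; first exact: pos.
  move=> r; have := congr1 (fun f : V => f r) E; rewrite sum_ffunE [in RHS]ffunE.
  rewrite (bigD1 u) //= linearZ /= ffunE /GRing.scale /= => Er.
  have w1 : 1 <= ew u s by apply: edge_weight_ge1; rewrite // coxeter_graph_sym.
  have f0 : 0 <= frieze k (root u) r by apply: pos.
  rewrite [leRHS]ffunE oppr_ge0.
  have : ew u s * frieze k (root u) r <= 0.
    rewrite -Er lerDl; apply: sumr_ge0 => v vu; rewrite linearZ ffunE /GRing.scale /=.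
    have [vS|nvS] := boolP (v \in S); last by rewrite /edge_weight (negPf nvS) /= mul0r.
    by apply: mulr_ge0; [apply: edge_weight_ge0 | apply: pos].
  nra.
have /connectP[p] := conn s0 t s0S tS.
elim: p s0 z0 {s0S} => [|u p IH] s z /=; first by move=> _ ->.
by case/andP=> su pp; apply: IH => //; apply: step su z.
Qed.

(* Let [k] be minimal such that [k] layers make some simple root negative. Then
   [frieze k] vanishes on all simple roots, so [frieze] is antisymmetric around
   [k]; hence [k] layers make every simple root negative, [2 k] layers fix them,
   and [k] is a multiple of the order, less than twice it. *)
Lemma layers_longest b t : irreducible_coxeter S -> t \in S ->
  rdesc (lay b #[L true * L false]%g) t.
Proof.
move=> irr; set h := #[_]%g => tS.
have Wlay c n : lay c n \in W by rewrite word_in ?layers_word.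
have WL c : L c \in W by rewrite word_in ?layer_word.
have orderL c : #[L c * L (~~ c)]%g = h by case: c => //=; rewrite order_mulgC.
have h0 : (0 < h)%N by apply: order_gt0.
pose P k := [exists s in S, rdesc (lay (col s) k) s].
have L_neg s : s \in S -> rho (L (col s)) (root s) = - root s.
  by move=> sS; apply: layer_same; apply: colored_simple.
(* All [2h] layers multiply to the identity. The leftmost one has the colour of [t] and negates
   [root t], so the other [2h - 1] send [root t] to its opposite. *)
have Ph : P h.*2.-1.
  apply/exists_inP; exists t => //; apply/rdescP => //.
  have E : lay (col t) h.*2 = 1%g by rewrite lay_double -(orderL (col t)) expg_order.
  have : rho (lay (col t) h.*2) (root t) = root t by rewrite E rho1.
  have -> : h.*2 = h.*2.-1.+1 by rewrite prednK // double_gt0.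
  have oh : ~~ odd h.*2.-1.+1 by rewrite prednK ?double_gt0 ?odd_double.
  rewrite [layers _ _ _ _]/= word_prod_cat rhoM // -[~~ odd _]/(odd _.+1) (negPf oh) addbF.
  move/(congr1 (rho (L (col t))^-1%g)); rewrite rhoK // => ->.
  have := congr1 (rho (L (col t))^-1%g) (L_neg t tS); rewrite rhoK // rhoN ?groupV // => <-.
  exact: nonneg_simple.
case: (ex_minnP (ex_intro P _ Ph)) => k /exists_inP[s0 s0S D0] kmin.
have kh : (k <= h.*2.-1)%N by apply: kmin.
have k0 : (0 < k)%N.
  by case: (k) D0 => //; rewrite word_prod_nil (negPf (rdescN1 s0S)).
have pos i s : (i < k)%N -> s \in S ->
    nonneg (frieze i.+1 (root s)) /\ nonneg (frieze i (root s)).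
  move=> ik sS; apply: nonneg_frieze => //; rewrite -rho_layers //.
  apply: nrdesc_nonneg => //; apply: contraL ik => D; rewrite -leqNgt; apply: kmin.
  by apply/exists_inP; exists s.
have pos' s : s \in S -> nonneg (frieze k (root s)).
  by move=> sS; have := pos k.-1 s; rewrite prednK // leqnn => /(_ isT sS)[].
(* At [k] the sum of the two friezes is nonpositive, hence so is each of them by disjointness of
   supports; minimality makes [frieze k] nonnegative as well. *)
have z0 : frieze k (root s0) = 0.
  apply: nonneg_anti; first exact: pos'.
  have := rdescP (Wlay (col s0) k) s0S; rewrite rho_layers // => -[/(_ D0) + _].
  rewrite opprD => neg.
  have := @frieze_colored k.+1 _ _ (colored_simple s0S).
  have := @frieze_colored k _ _ (colored_simple s0S).
  rewrite [odd k.+1]/= negbK => c1 c2 r; rewrite ffunE; have := neg r; rewrite !ffunE.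
  have [Hr|/c1->] := boolP ((r \in S) && (col r == col s0 (+) ~~ odd k)); last by rewrite oppr0.
  by rewrite (coloredN c2) ?oppr0 ?add0r // -addbN.
have z := frieze_eq0 irr s0S pos' z0.
have anti s j : s \in S -> (j <= k)%N -> frieze (k + j) (root s) = - frieze (k - j) (root s).
  move=> sS; apply: (@recurrence_antisym V adjacency (fun n => frieze n (root s))) => //.
  exact: z.
(* By antisymmetry about [k], the first [2k - 1] layers to act give [- root s]; the leftmost layer
   has the colour of [s] and restores the sign. *)
have fix2k s : s \in S -> rho (lay (col s) k.*2) (root s) = root s.
  move=> sS; have Ek : k.*2 = (k + k.-1).+1 by rewrite -addnn -addnS prednK.
  rewrite Ek [layers _ _ _ _]/= word_prod_cat rhoM // rho_layers //.
  have -> : ~~ odd (k + k.-1) = false by rewrite -[LHS]/(odd (k + k.-1).+1) -Ek odd_double.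
  rewrite addbF -Ek -addnn !anti // ?leq_pred // subnn oppr0 add0r.
  have -> : (k - k.-1 = 1)%N by lia.
  by rewrite rhoN // L_neg // opprK.
have hk : (h %| k)%N.
  rewrite order_dvdn; apply/eqP; apply: rho_faithful => [|s sS].
    by rewrite groupX // groupM.
  have := fix2k s sS; rewrite lay_double; case: (col s) => //= E.
  have WX : ((L true * L false) ^+ k)%g \in W by rewrite groupX ?groupM.
  have V : (L false * L true = (L true * L false)^-1)%g by rewrite invMg !layer_inv.
  by rewrite V expgVn in E; rewrite -{1}E -rhoM ?groupV // mulgV rho1.
have {hk}kE : k = h.
  move: hk => /dvdnP[q Eq]; move: kh k0; rewrite Eq; case: q {Eq} => [|[|q]] //; nia.
rewrite -kE; apply/rdescP => //.
have [->|ct] := eqVneq b (col t).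
  rewrite rho_layers // z // addr0 -addn1 anti // opprK.
  by have := pos k.-1 t; rewrite prednK // leqnn subn1 => /(_ isT tS)[].
(* In this case the rightmost layer contains [t] and negates [root t]; the other [k - 1] layers keep
   [root t] positive by minimality of [k]. *)
have -> : b = ~~ col t by case: (b) (col t) ct => [] [].
rewrite -[k]prednK // layersSr negbK word_prod_cat rhoM // L_neg // rhoN // opprK.
rewrite rho_layers //; apply: nonnegD.
  by rewrite prednK //; apply: pos'.
by have [] := pos k.-1 t; rewrite ?prednK.
Qed.

End Roots.

(** * Subwords and the weak order *)

Section RootFree.
Local Open Scope group_scope.
Variables (gT : finGroupType) (S : {set gT}).
Hypothesis coxS : coxeter_system S.
Local Notation W := <<S>>.
Local Notation rdesc := (rdesc S).
Local Notation len := (len S).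
Implicit Types (x y : gT) (s t : gT).

(** Discharges the assumptions of the root section, so that its consequences can be restated purely
    in terms of the group. *)
Lemma geometric_representation : exists (cs : nat -> Rdefinitions.R)
    (rho : gT -> {ffun gT -> Rdefinitions.R^o} -> {ffun gT -> Rdefinitions.R^o}),
  [/\ forall m, (1 < m)%N -> is_double_cos_pi_over m (cs m),
      {in W &, forall x y v, rho (x * y) v = rho x (rho y v)},
      {in S, forall s v, rho s v = refl S cs s v} & forall v, rho 1 v = v].
Proof.
have [cs csP] := double_cos_exists.
have [s t sS tS v|rho [rhoM rhoS rho1]] := coxeter_action coxS (@reflK gT S _ cs).
  exact: refl_order.
by exists cs, rho.
Qed.

Lemma rdesc_mul_commuting x s t : x \in W -> s \in S -> t \in S -> s != t ->
  ~~ coxeter_graph S s t -> rdesc (x * s) t = rdesc x t.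
Proof.
have [cs [rho [csP rhoM rhoS rho1]]] := geometric_representation.
exact: rdesc_commute rhoM rhoS rho1 _ _ _.
Qed.

Lemma rdesc_pair_alternating x s t : x \in W -> s \in S -> t \in S -> s != t ->
  rdesc x s -> rdesc x t ->
  exists2 v, v \in W & x = v * alternating s t #[s * t] /\ len x = (len v + #[s * t])%N.
Proof.
have [cs [rho [csP rhoM rhoS rho1]]] := geometric_representation.
exact: rdesc_pair rhoM rhoS rho1 _ _ _.
Qed.

Lemma exchange x a s : x \in W -> a \in S -> s \in S ->
  ~~ rdesc x s -> rdesc (a * x) s -> a * x = x * s.
Proof.
have [cs [rho [csP rhoM rhoS rho1]]] := geometric_representation.
exact: rdesc_lift rhoM rhoS rho1 _ _ _.
Qed.

Lemma coxeter_graph_leaf (T : {set gT}) : T \subset S -> T != set0 ->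
  exists2 t, t \in T & (#|[set u in T | coxeter_graph S t u]| <= 1)%N.
Proof.
have [cs [rho [csP rhoM rhoS rho1]]] := geometric_representation.
exact: coxeter_graph_sparse rhoM rhoS rho1 T.
Qed.

Lemma rdesc_longestM p y s : p \in W -> y \in W -> s \in S ->
  (forall t, t \in S -> rdesc p t) -> ~~ rdesc y s -> rdesc (p * y) s.
Proof.
have [cs [rho [csP rhoM rhoS rho1]]] := geometric_representation.
exact: rdesc_longest rhoM rhoS rho1 p y s.
Qed.

Lemma rdesc_alternating_layers (col : gT -> bool) b t :
  (forall s u, coxeter_graph S s u -> col s != col u) -> irreducible_coxeter S ->
  t \in S -> rdesc (word_prod (layers S col b
    #[word_prod (layer S col true) * word_prod (layer S col false)])) t.
Proof.
have [cs [rho [csP rhoM rhoS rho1]]] := geometric_representation.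
by move=> colP; apply: (layers_longest coxS csP rhoM rhoS rho1 colP).
Qed.

End RootFree.

(** * Subwords and deletion of letters *)

Section Subwords.
Local Open Scope group_scope.
Variables (gT : finGroupType) (S : {set gT}).
Hypothesis coxS : coxeter_system S.
Local Notation W := <<S>>.
Local Notation rdesc := (rdesc S).
Local Notation len := (len S).
Implicit Types (x y u v : gT) (s t : gT) (w : seq gT).

(** The exchange condition for words that need not be reduced: the deleted letter is one whose
    addition on the left turns [s] into a descent. *)
Lemma word_prod_delete w s : is_word S w -> s \in S -> rdesc (word_prod w) s ->
  exists2 w', subseq w' w & word_prod w' = word_prod w * s.
Proof.
move=> + sS; elim: w => [|a w IH] /=; first by rewrite word_prod_nil (negPf (rdescN1 sS)).
case/andP=> aS wS; rewrite word_prod_cons => D.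
have [/(IH wS)[w' sub Ew']|Dw] := boolP (rdesc (word_prod w) s).
  by exists (a :: w'); rewrite ?word_prod_cons ?Ew' ?mulgA //= eqxx.
exists w; first exact: subseq_cons.
rewrite (exchange coxS _ aS sS Dw D) ?word_in // -mulgA.
by rewrite (simple_mulss coxS sS) mulg1.
Qed.

(** For reduced [w] this is the Bruhat order below [word_prod w]. *)
Definition subword_prod w x := exists2 w', subseq w' w & word_prod w' = x.

Lemma is_word_subseq w w' : is_word S w -> subseq w' w -> is_word S w'.
Proof. by move=> wS /mem_subseq sub; apply/allP=> s /sub; apply: (allP wS). Qed.

Lemma subword_prod_in w x : is_word S w -> subword_prod w x -> x \in W.
Proof. by move=> wS [w' /(is_word_subseq wS) w'S <-]; apply: word_in. Qed.

Lemma subword_prod_rdesc w x s : is_word S w -> s \in S ->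
  subword_prod w x -> rdesc x s -> subword_prod w (x * s).
Proof.
move=> wS sS [w' sub <-] D.
have [u su <-] := word_prod_delete (is_word_subseq wS sub) sS D.
by exists u => //; apply: subseq_trans su sub.
Qed.

(** Whether or not the subword uses the final [s], one of [x] and [x s] is a subword product of [w];
    deletion passes to the shorter of the two. *)
Lemma subword_prod_rcons w x s : is_word S w -> s \in S -> subword_prod (rcons w s) x ->
  if rdesc x s then subword_prod w (x * s) else subword_prod w x.
Proof.
move=> wS sS [w' sub xE].
have Wx : x \in W.
  by apply: (@subword_prod_in (rcons w s)); rewrite ?is_word_rcons ?sS //; exists w'.
have [] : subword_prod w x \/ subword_prod w (x * s).
  move: sub xE; case/subseqP => m; case/lastP: m => [|m b]; first by rewrite size_rcons.
  rewrite !size_rcons => -[szm] ->; rewrite mask_rcons //.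
  case: b => /=; rewrite ?cats0 ?cats1 ?word_prod_rcons => <-; [right|left].
    by rewrite (simpleKr coxS sS); exists (mask m w) => //; apply: mask_subseq.
  by exists (mask m w) => //; apply: mask_subseq.
- by move=> sub'; case: ifP => // D; apply: subword_prod_rdesc.
- move=> sub'; case: ifP => // /negbT D; rewrite -[x](simpleKr coxS sS).
  by apply: subword_prod_rdesc => //; rewrite rdescMs.
Qed.

(** The weak order as additivity of lengths, which is decidable and free of words; [weak_leP]
    compares it with [weak_le]. *)
Definition wle u v := len v == (len u + len (u^-1 * v))%N.

Lemma wle_refl u : wle u u. Proof. by rewrite /wle mulVg len1 addn0. Qed.

Lemma wle1 u : wle 1 u. Proof. by rewrite /wle invg1 mul1g len1. Qed.

Lemma wle_trans u v x : u \in W -> v \in W -> x \in W -> wle u v -> wle v x -> wle u x.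
Proof.
move=> Wu Wv Wx /eqP Ev /eqP Ex; rewrite /wle eqn_leq; apply/andP; split.
  by rewrite -{1}[x](mulKVg u) lenM //; in_gen.
rewrite Ex Ev -addnA leq_add2l.
have -> : u^-1 * x = (u^-1 * v) * (v^-1 * x) by rewrite mulgA mulgK.
by apply: lenM; in_gen.
Qed.

Lemma wle_len u v : wle u v -> (len u <= len v)%N.
Proof. by move/eqP->; apply: leq_addr. Qed.

Lemma wle_len_eq u v : u \in W -> v \in W -> wle u v -> (len v <= len u)%N -> u = v.
Proof.
move=> Wu Wv /eqP E l; have : len (u^-1 * v) = 0%N by lia.
by move/(len_eq0 (groupM (groupVr Wu) Wv))/eqP; rewrite -eq_mulVg1 => /eqP.
Qed.

Lemma wle_rdesc u v s : u \in W -> v \in W -> s \in S -> wle u v ->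
  rdesc (u^-1 * v) s -> rdesc v s /\ wle u (v * s).
Proof.
move=> Wu Wv sS /eqP E D; have Wq : u^-1 * v \in W by in_gen.
have Eq := len_rdesc coxS Wq sS D.
have l : (len (v * s) <= len u + len (u^-1 * v * s))%N.
  have -> : v * s = u * (u^-1 * v * s) by rewrite -mulgA mulKVg.
  by apply: lenM; in_gen.
have Dv : rdesc v s by rewrite /rdesc E Eq addnS ltnS.
split=> //; rewrite /wle mulgA; apply/eqP/succn_inj.
by rewrite -(len_rdesc coxS Wv sS Dv) E Eq addnS.
Qed.

Lemma wle_rdescK u v s : u \in W -> v \in W -> s \in S -> rdesc v s -> wle u v ->
  wle u (v * s) -> rdesc (u^-1 * v) s.
Proof.
move=> Wu Wv sS D /eqP E1 /eqP E2; rewrite /rdesc -(ltn_add2l (len u)).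
by rewrite -E1 -mulgA -E2.
Qed.

Lemma subword_prod_wle w u v : is_word S w -> u \in W ->
  wle u v -> subword_prod w v -> subword_prod w u.
Proof.
move=> wS Wu; have [n] := ubnP (len (u^-1 * v)); elim: n v => // n IH v le_n luv sub.
have Wv := subword_prod_in wS sub; have Wq : u^-1 * v \in W by in_gen.
have [E|q1] := eqVneq (u^-1 * v) 1.
  by move/eqP: E; rewrite -eq_mulVg1 => /eqP ->.
have [s sS D] := rdesc_exists coxS Wq q1; have [Dv le'] := wle_rdesc Wu Wv sS luv D.
apply: IH le' (subword_prod_rdesc wS sS sub Dv).
by rewrite mulgA -ltnS -(len_rdesc coxS Wq sS D).
Qed.

(* [u] lies below the element obtained from [x] by descending along all
   available letters of the commuting layer [a]. *)
Lemma subword_prod_cat w a u x : is_word S w -> is_word S a -> uniq a ->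
  {in a &, forall s t, ~~ coxeter_graph S s t} -> u \in W ->
  wle u x -> {in a, forall s, rdesc x s -> rdesc (u^-1 * x) s} ->
  subword_prod (w ++ a) x -> subword_prod w u.
Proof.
move=> wS; elim/last_ind: a x => [|a s IH] x; first by rewrite cats0 => _ _ _ Wu l _; apply: subword_prod_wle.
rewrite is_word_rcons rcons_uniq -rcons_cat => /andP[sS aS] /andP[sa au] nadj Wu lux D sub.
have mem_sub b : b \in a -> b \in rcons a s by rewrite mem_rcons inE orbC => ->.
have s_in : s \in rcons a s by rewrite mem_rcons mem_head.
have waS : is_word S (w ++ a) by rewrite is_word_cat wS.
have Wx : x \in W.
  by apply: subword_prod_in sub; rewrite is_word_rcons sS.
have {}IH := IH _ aS au (fun b c ba ca => nadj b c (mem_sub _ ba) (mem_sub _ ca)) Wu.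
have := subword_prod_rcons waS sS sub.
case: ifP => Dx subx.
  have Dq := D s (s_in) Dx; have [_ le'] := wle_rdesc Wu Wx sS lux Dq.
  (* The letters of the layer commute, so multiplying by [s] does not change whether [b] is a
     descent of [x] or of [u^-1 x]. *)
  apply: IH subx => // b ba; have bS := allP aS b ba.
  have sb : s != b by apply: contraNneq sa => ->.
  have nsb : ~~ coxeter_graph S s b by apply: nadj; rewrite ?s_in ?mem_sub.
  have Wq : u^-1 * x \in W by in_gen.
  rewrite mulgA (rdesc_mul_commuting coxS Wx) // (rdesc_mul_commuting coxS Wq) //.
  exact: (D b (mem_sub _ ba)).
by apply: IH subx => // b ba; exact: (D b (mem_sub _ ba)).
Qed.

End Subwords.

(** * Meets in the weak order *)

Section WeakOrder.
Local Open Scope group_scope.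
Variables (gT : finGroupType) (S : {set gT}).
Hypothesis coxS : coxeter_system S.
Local Notation W := <<S>>.
Local Notation rdesc := (rdesc S).
Local Notation len := (len S).
Local Notation wle := (wle S).
Implicit Types (x y u v z : gT) (s t : gT) (w : seq gT).

(** Write [x = p y]. Multiplying [p] by the letters of a reduced word of [y] descends at each step,
    so deletion applies every time. *)
Lemma subword_prod_longest w x : is_word S w ->
  (forall s, s \in S -> rdesc (word_prod w) s) -> x \in W -> subword_prod w x.
Proof.
move=> wS desc Wx; set p := word_prod w; have Wp : p \in W by apply: word_in.
suff P y : y \in W -> subword_prod w (p * y) by rewrite -[x](mulKVg p); apply: P; in_gen.
have [n] := ubnP (len y); elim: n y => // n IH y le_n Wy.
have [->|y1] := eqVneq y 1; first by rewrite mulg1; exists w.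
have [s sS D] := rdesc_exists coxS Wy y1; have Wys : y * s \in W by in_gen.
have Dys : ~~ rdesc (y * s) s by rewrite rdescMs // D.
rewrite -[y](simpleKr coxS sS) /= mulgA; apply: (subword_prod_rdesc coxS) => //.
  by apply: IH => //; rewrite -ltnS -(len_rdesc coxS Wy sS D).
exact: rdesc_longestM.
Qed.

Lemma len_simple1 s : s \in S -> len s = 1%N.
Proof.
move=> sS; apply/eqP; rewrite eqn_leq len_simple //= lt0n.
apply: contra (simple_neq1 coxS sS) => /eqP l0.
by apply/eqP; apply: (len_eq0 (mem_gen sS) l0).
Qed.

Lemma wle_simple s x : s \in S -> x \in W -> wle s x = rdesc x^-1 s.
Proof.
move=> sS Wx; have Wxi : x^-1 \in W by in_gen.
have E : len (s^-1 * x) = len (x^-1 * s).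
  by rewrite -lenV ?invMg ?invgK //; in_gen.
rewrite /wle E (len_simple1 sS) -(lenV coxS Wx); apply/eqP/idP => [l|D].
  by rewrite /rdesc [leqRHS]l add1n.
by rewrite add1n; apply: len_rdesc.
Qed.

Lemma wle_simpleM s u v : s \in S -> u \in W -> v \in W -> wle s u -> wle s v ->
  wle (s * u) (s * v) = wle u v.
Proof.
move=> sS Wu Wv /eqP lu /eqP lv.
rewrite /wle invMg -mulgA mulKg lu lv (len_simple1 sS) (simple_inv coxS sS).
by rewrite -addnA eqn_add2l.
Qed.

(** Descents are taken on the right, hence the passage to inverses: [x^-1] has both descents and so
    ends in the longest element of the dihedral subgroup. *)
Lemma wle_simple_join s t x : s \in S -> t \in S -> s != t -> x \in W ->
  wle s x -> wle t x ->
  let d := (alternating s t #[s * t])^-1 in [/\ wle s d, wle t d & wle d x].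
Proof.
move=> sS tS st Wx; rewrite !wle_simple // => Ds Dt d.
have Wxi : x^-1 \in W by in_gen.
have [v Wv [Ex lx]] := rdesc_pair_alternating coxS Wxi sS tS st Ds Dt.
have Wa : alternating s t #[s * t] \in W by apply: alternating_in.
have Wd : d \in W by in_gen.
have ld : len d = #[s * t].
  rewrite lenV //; apply/eqP; rewrite eqn_leq len_alternating //=.
  by rewrite -(leq_add2l (len v)) -lx Ex lenM.
have desc a b : a \in S -> b \in S ->
    alternating b a #[s * t] = alternating s t #[s * t] -> wle a d.
  move=> aS bS Ea; rewrite wle_simple // /rdesc (lenV coxS Wd) ld.
  have -> : d^-1 = alternating b a #[s * t] by rewrite Ea invgK.
  have := order_gt0 (s * t); case: #[_] => // m _.
  by rewrite alternatingSr (simpleKr coxS aS) ltnS len_alternating.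
split.
- by apply: (desc s t) => //; rewrite (alternating_order coxS).
- exact: (desc t s).
have Edx : d^-1 * x = v^-1 by rewrite -[x]invgK Ex invMg -/d mulKg.
by rewrite /wle Edx (lenV coxS Wv) -(lenV coxS Wx) lx ld addnC.
Qed.

(* If no simple reflection lies below both elements the meet is [1]; otherwise
   factor out a common [s], and use the join of [s] and [t] to see that the
   resulting lower bound does not depend on [s]. *)
Lemma wle_meet x y : x \in W -> y \in W -> exists2 z, z \in W &
  [/\ wle z x, wle z y & forall u, u \in W -> wle u x -> wle u y -> wle u z].
Proof.
have [n] := ubnP (len x); elim: n x y => // n IH x y le_n Wx Wy.
have part s : s \in S -> wle s x -> wle s y -> exists2 z, z \in W &
    [/\ wle s z, wle z x, wle z y &
        forall u, u \in W -> wle s u -> wle u x -> wle u y -> wle u z].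
  move=> sS sx sy; have Wsx : s * x \in W by in_gen.
  have Wsy : s * y \in W by in_gen.
  have lsx : len x = (len (s * x)).+1.
    by have /eqP := sx; rewrite (len_simple1 sS) (simple_inv coxS sS) add1n.
  have [|z Wz [zx zy zmax]] := IH (s * x) (s * y) _ Wsx Wsy; first by rewrite -ltnS -lsx.
  have Wsz : s * z \in W by in_gen.
  have ssz : wle s (s * z).
    rewrite /wle (len_simple1 sS) mulKg eqn_leq.
    have /eqP lz := zx.
    have Wr : z^-1 * (s * x) \in W by in_gen.
    have : (len x <= len (s * z) + len (z^-1 * (s * x)))%N.
      rewrite -{1}[x](simpleK coxS sS) -{1}(mulKVg z (s * x)) mulgA; exact: lenM.
    rewrite lsx lz -addSn leq_add2r add1n => ->; rewrite andbT.
    by rewrite -add1n -(len_simple1 sS); apply: lenM => //; apply: mem_gen.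
  have sK u : s * (s * u) = u by exact: (simpleK coxS sS).
  exists (s * z) => //; split=> //.
  - by rewrite -(wle_simpleM sS) // sK.
  - by rewrite -(wle_simpleM sS) // sK.
  move=> u Wu su ux uy; have Wsu : s * u \in W by in_gen.
  rewrite -(wle_simpleM sS) // sK; apply: zmax => //.
    by rewrite wle_simpleM.
  by rewrite wle_simpleM.
have [/existsP[s /and3P[sS sx sy]]|none] :=
    boolP [exists s, [&& s \in S, wle s x & wle s y]]; last first.
  exists 1; rewrite ?group1 //; split; try exact: wle1.
  move=> u Wu ux uy; have [->|u1] := eqVneq u 1; first exact: wle_refl.
  have Wui : u^-1 \in W by in_gen.
  have [|s sS D] := rdesc_exists coxS Wui; first by rewrite eq_invg1.
  rewrite -wle_simple // in D; case/existsP: none; exists s.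
  have Ws : s \in W by apply: mem_gen.
  by rewrite sS (wle_trans Ws Wu Wx D ux) (wle_trans Ws Wu Wy D uy).
have Ws : s \in W by apply: mem_gen.
have [z Wz [sz zx zy zmax]] := part s sS sx sy.
exists z => //; split=> // u Wu ux uy.
have [->|u1] := eqVneq u 1; first exact: wle1.
have Wui : u^-1 \in W by in_gen.
have [|t tS D] := rdesc_exists coxS Wui; first by rewrite eq_invg1.
rewrite -wle_simple // in D; have Wt : t \in W by apply: mem_gen.
have tx : wle t x by apply: (wle_trans Wt Wu Wx).
have ty : wle t y by apply: (wle_trans Wt Wu Wy).
have [Est|st] := eqVneq s t; first by apply: zmax => //; rewrite Est.
have [z' Wz' [tz' z'x z'y z'max]] := part t tS tx ty.
(* The join [d] of [s] and [t] lies below [x] and [y], hence below [z']. So [s] lies below [z'],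
   which gives [z'] below [z]. *)
have := wle_simple_join sS tS st Wx sx tx; have := wle_simple_join sS tS st Wy sy ty.
set d := _^-1 => /= -[_ _ dy] [sd td dx].
have Wd : d \in W by rewrite groupV alternating_in.
have dz' : wle d z' by apply: z'max.
have sz' : wle s z' by apply: (wle_trans Ws Wd Wz').
have z'z : wle z' z by apply: zmax.
by apply: (wle_trans Wu Wz' Wz) z'z; apply: z'max.
Qed.

Lemma reduced_wordP w : reduced_word S w <-> is_word S w /\ size w = len (word_prod w).
Proof.
split=> [[wS min]|[wS E]].
  split=> //; apply/eqP; rewrite eqn_leq len_le_size // andbT.
  have [u [uS Eu <-]] := len_word (word_in wS); exact: min.
by split=> // u uS Eu; rewrite E -Eu len_le_size.
Qed.

Lemma weak_leP u v : u \in W -> v \in W -> weak_le S u v <-> wle u v.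
Proof.
move=> Wu Wv; split=> [[w [/reduced_wordP[wS sw] Ev [k [/reduced_wordP[kS sk] Eu]]]]|/eqP E].
  have dS : is_word S (drop k w) by rewrite -[w](cat_take_drop k) is_word_cat in wS; case/andP: wS.
  have Eq : u^-1 * v = word_prod (drop k w).
    by rewrite -Ev -[w in LHS](cat_take_drop k) word_prod_cat Eu mulKg.
  rewrite /wle eqn_leq; apply/andP; split.
    by rewrite -{1}[v](mulKVg u) lenM //; in_gen.
  rewrite Eq -{1}Eu -sk -Ev -sw.
  have -> : size w = size (take k w) + size (drop k w) by rewrite -size_cat cat_take_drop.
  rewrite leq_add2l.
  exact: len_le_size.
have [a [aS Ea sa]] := len_word Wu.
have [b [bS Eb sb]] := len_word (groupM (groupVr Wu) Wv).
exists (a ++ b); split.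
- apply/reduced_wordP; rewrite is_word_cat aS bS; split=> //.
  by rewrite word_prod_cat size_cat Ea Eb mulKVg sa sb E.
- by rewrite word_prod_cat Ea Eb mulKVg.
exists (size a); rewrite take_size_cat //; split=> //.
by apply/reduced_wordP; rewrite Ea.
Qed.

End WeakOrder.

(** * Coxeter elements *)

Section CoxeterElements.
Local Open Scope group_scope.
Variables (gT : finGroupType) (S : {set gT}).
Hypothesis coxS : coxeter_system S.
Implicit Types (s t a b : gT) (w p q : seq gT).

(* Reorderings that do not change the conjugacy class of the product. *)
Inductive rot_equiv : seq gT -> seq gT -> Prop :=
| RotRefl w : rot_equiv w w
| RotSym p q : rot_equiv p q -> rot_equiv q p
| RotTrans p q w : rot_equiv p q -> rot_equiv q w -> rot_equiv p w
| RotSwap p a b q : commute a b -> rot_equiv (p ++ a :: b :: q) (p ++ b :: a :: q)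
| RotCons a q : rot_equiv (a :: q) (rcons q a).

Lemma rot_equiv_order p q : rot_equiv p q -> #[word_prod p] = #[word_prod q].
Proof.
elim=> // {p q} [p q w _ -> //|p a b q E|a q].
  by rewrite !word_prod_cat !word_prod_cons !mulgA -(mulgA _ a b) E mulgA.
by rewrite word_prod_cons word_prod_rcons order_mulgC.
Qed.

Lemma rot_equiv_perm p q : rot_equiv p q -> perm_eq p q.
Proof.
elim=> // {p q} [p q _|p q w _ E _|p a b q _|a q].
- by rewrite perm_sym.
- exact: perm_trans.
- by apply/seq.permP => c; rewrite !count_cat /=; congr (_ + _)%N; rewrite addnCA.
by rewrite perm_sym perm_rcons.
Qed.

Lemma rot_equiv_catC p q : rot_equiv (p ++ q) (q ++ p).
Proof.
elim: p q => [|a p IH] q; first by rewrite cats0; apply: RotRefl.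
apply: RotTrans (RotCons _ _) _; rewrite rcons_cat -cat_rcons.
exact: IH.
Qed.

Lemma rot_equiv_move p s q w : {in q, forall a, commute s a} ->
  rot_equiv (p ++ s :: q ++ w) (p ++ q ++ s :: w).
Proof.
elim: q p => [|a q IH] p comm; first exact: RotRefl.
apply: RotTrans (RotSwap _ _ (comm a (mem_head _ _))) _.
rewrite -cat_rcons -[p ++ (a :: q) ++ _]cat_rcons; apply: IH => b bq.
by apply: comm; rewrite inE bq orbT.
Qed.

(** Here [s] is a leaf with only possible neighbour [t]. The delicate case rotates [t] itself: [s]
    is first rotated to the end and then moved back through the other letters, with which it
    commutes. *)
Lemma rot_equiv_cons s t p q : uniq p ->
  {in p, forall a, a != t -> commute s a} ->
  rot_equiv p q -> rot_equiv (s :: p) (s :: q).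
Proof.
move=> + + E; elim: E => {p q} [w|p q E IH|p q w E1 IH1 E2 IH2|p a b q E|a q] up comm.
- exact: RotRefl.
- apply: RotSym; apply: IH; first by rewrite (perm_uniq (rot_equiv_perm E)).
  by move=> a; rewrite (perm_mem (rot_equiv_perm E)); apply: comm.
- apply: RotTrans (IH1 _ _) (IH2 _ _) => //.
    by rewrite -(perm_uniq (rot_equiv_perm E1)).
  by move=> a; rewrite -(perm_mem (rot_equiv_perm E1)); apply: comm.
- by rewrite -!cat_cons; apply: RotSwap.
have [Ea|at'] := eqVneq a t; last first.
  apply: RotTrans (RotSwap [::] _ (comm a (mem_head _ _) at')) _.
  exact: RotCons.
rewrite Ea in up comm *.
apply: RotTrans (RotCons _ _) _; rewrite rcons_cons.
apply: RotTrans (RotCons t (s :: q)); apply: RotSym.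
have comm_q : {in q, forall b, commute s b}.
  move=> b bq; apply: comm; first by rewrite inE bq orbT.
  by apply: contraTneq bq => ->; case/andP: up.
by have := rot_equiv_move [:: t] [::] comm_q; rewrite cats0 /= cats1.
Qed.

Lemma nonadjacent_commute s t : s \in S -> t \in S -> ~~ coxeter_graph S s t -> commute s t.
Proof.
move=> sS tS; rewrite /coxeter_graph sS tS /= -ltnNge ltnS => o2.
have [->//|st] := eqVneq s t; have o1 := simple_order_gt1 coxS sS tS st.
have : (s * t) ^+ 2 = 1 by apply/eqP; rewrite -order_dvdn; case: #[_] o1 o2 => [|[|[|]]].
move/eqP; rewrite expgS expg1 -eq_invg_mul => /eqP E; rewrite /commute -{1}E.
by rewrite invMg !(simple_inv coxS).
Qed.

Lemma leaf_neighbour (T : {set gT}) : T \subset S -> T != set0 ->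
  exists s t, [/\ s \in T, s != t & {in T, forall a, a != t -> ~~ coxeter_graph S s a}] .
Proof.
move=> TS T0; have [s sT le1] := coxeter_graph_leaf coxS TS T0.
have sS := subsetP TS s sT.
have nss : ~~ coxeter_graph S s s by rewrite /coxeter_graph (simple_mulss coxS sS) order1 !andbF.
have [/eqP|] := posnP #|[set u in T | coxeter_graph S s u]|.
  (* An isolated [s] receives [1] as a dummy neighbour, which differs from every simple
     reflection. *)
  rewrite cards_eq0 => /eqP N0; exists s, 1; split=> //; first exact: simple_neq1 sS.
  move=> a aT _; have := in_set0 a; rewrite -N0 inE aT /=; by move->.
move=> gt0; have /cards1P[t Nt] : #|[set u in T | coxeter_graph S s u]| == 1%N.
  by rewrite eqn_leq le1.
exists s, t; split=> //; first apply: contraNneq nss => E.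
  by have := set11 t; rewrite -Nt inE -E => /andP[].
by move=> a aT; rewrite -in_set1 -Nt inE aT.
Qed.

(** Rotate a leaf to the front of both words and compare the remainders by induction. *)
Lemma rot_equiv_all p q : uniq p -> {subset p <= S} -> perm_eq p q -> rot_equiv p q.
Proof.
have [n] := ubnP (size p); elim: n p q => // n IH p q le_n up pS pq.
have [p0|p0] := eqVneq p [::].
  by move: pq; rewrite p0 perm_sym => /perm_nilP ->; apply: RotRefl.
have [||s [t [sp st nadj]]] := @leaf_neighbour [set a in p].
- by apply/subsetP => a; rewrite inE; apply: pS.
- by case: (p) p0 => // a r _; apply/set0Pn; exists a; rewrite inE mem_head.
rewrite inE in sp; have sq : s \in q by rewrite -(perm_mem pq).
have uq : uniq q by rewrite -(perm_uniq pq).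
have E r : uniq r -> s \in r -> exists2 r', rot_equiv r (s :: r') & perm_eq r (s :: r').
  move=> ur sr; case/splitPr: sr ur => r1 r2 _; exists (r2 ++ r1).
    by apply: RotTrans (rot_equiv_catC _ _) _; apply: RotRefl.
  by rewrite perm_catC.
have [p' ep pp'] := E p up sp; have [q' eq qq'] := E q uq sq.
apply: RotTrans ep (RotTrans _ (RotSym eq)).
have up' : uniq (s :: p') by rewrite -(perm_uniq pp').
have sub a : a \in p' -> a \in p by rewrite (perm_mem pp') inE orbC => ->.
apply: (@rot_equiv_cons s t).
- by case/andP: up'.
- move=> a ap' at'; apply: nonadjacent_commute; [exact: pS | exact/pS/sub | ].
  by apply: nadj; rewrite ?inE ?sub.
apply: IH.
- by rewrite -ltnS; move/perm_size: pp' => /= <-.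
- by case/andP: up'.
- by move=> a /sub; apply: pS.
by rewrite -(perm_cons s); rewrite perm_sym in pp'; apply: perm_trans pp' (perm_trans pq qq').
Qed.

(** Remove a leaf, colour the rest, and give the leaf the colour opposite to its neighbour. *)
Lemma two_coloring : exists col : gT -> bool,
  forall s t, coxeter_graph S s t -> col s != col t.
Proof.
suff P n (T : {set gT}) : (#|T| <= n)%N -> T \subset S -> exists col : gT -> bool,
    {in T &, forall s t, coxeter_graph S s t -> col s != col t}.
  have [col colP] := P _ S (leqnn _) (subxx _).
  by exists col => s t st; have /and3P[sS tS _] := st; apply: colP.
elim: n T => [|n IH] T.
  by rewrite leqn0 cards_eq0 => /eqP -> _; exists xpred0 => s t; rewrite in_set0.
have [->|T0] := eqVneq T set0; first by exists xpred0 => s t; rewrite in_set0.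
move=> le_n TS; have [s [t [sT st nadj]]] := leaf_neighbour TS T0.
have [||col colP] := IH (T :\ s).
- by move: le_n; rewrite (cardsD1 s) sT.
- exact: subset_trans (subsetDl _ _) TS.
exists (fun a => if a == s then ~~ col t else col a) => a b aT bT ab.
have adj_t c : c \in T -> coxeter_graph S s c -> c = t.
  by move=> cT; apply: contraTeq => ct; apply: nadj.
have [Ea|as'] := eqVneq a s; have [Eb|bs] := eqVneq b s; rewrite ?Ea ?Eb in ab *.
- by move: st; rewrite (adj_t s sT ab) eqxx.
- by rewrite (adj_t b bT ab); case: (col t).
- by rewrite coxeter_graph_sym in ab; rewrite (adj_t a aT ab); case: (col t).
- by apply: colP; rewrite // !inE ?as' ?bs.
Qed.

Lemma coxeter_number_layers (col : gT -> bool) :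
  coxeter_number S = #[word_prod (layer S col true) * word_prod (layer S col false)].
Proof.
rewrite -word_prod_cat; apply: rot_equiv_order; apply: rot_equiv_all.
- exact: enum_uniq.
- by move=> a; rewrite mem_enum.
apply: uniq_perm; rewrite ?enum_uniq //.
  rewrite cat_uniq !layer_uniq andbT /=; apply/hasPn => a; rewrite !mem_layer.
  by case/andP=> -> /eqP ->.
by move=> a; rewrite mem_cat !mem_layer mem_enum -andb_orr; case: (col a); rewrite andbT.
Qed.

End CoxeterElements.

(** * Popping in lattice quotients *)

Section Pop.
Local Open Scope order_scope.
Variables (d : Order.disp_t) (L : finLatticeType d).
Implicit Types x y : L.

Lemma popdown_le x : popdown x <= x.
Proof. exact: leIl. Qed.

Lemma popdown_covby x y : covby y x -> popdown x <= y.
Proof.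
move=> yx; apply: le_trans (leIr _ _) _.
have : y \in index_enum L by rewrite mem_index_enum.
elim: (index_enum L) => [//|z r IH]; rewrite inE big_cons => /predU1P[<-|/IH le_r].
  by rewrite yx leIl.
by case: ifP => // _; apply: le_trans (leIr _ _) le_r.
Qed.

Lemma card_pop_orbit x h : (0 < h)%N ->
  popdown (iter h.-1 (@popdown d L) x) = iter h.-1 (@popdown d L) x ->
  (#|pop_orbit x| <= h)%N.
Proof.
move=> h0 fix_h; pose F (i : 'I_h) := iter i (@popdown d L) x.
have sub : pop_orbit x \subset F @: setT.
  apply/subsetP => y; rewrite inE => /iter_findex <-; move: (findex _ _ _) => n.
  have [lt_n|le_n] := ltnP n h; first by apply/imsetP; exists (Ordinal lt_n).
  have lt_h : (h.-1 < h)%N by rewrite prednK.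
  apply/imsetP; exists (Ordinal lt_h) => //; rewrite /F /=.
  have -> : n = ((n - h.-1) + h.-1)%N by rewrite subnK // (leq_trans (leq_pred h)).
  by rewrite iterD; elim: (n - h.-1)%N => //= m ->.
apply: leq_trans (subset_leq_card sub) _.
by apply: leq_trans (leq_imset_card _ _) _; rewrite cardsT card_ord.
Qed.

End Pop.

(** * Minimal lifts along the quotient map *)

Section Quotient.
Variables (gT : finGroupType) (S : {set gT}).
Variables (d : Order.disp_t) (L : finLatticeType d) (f : gT -> L).
Hypothesis coxS : coxeter_system S.
Hypothesis quot : weak_lattice_quotient_map S f.
Local Notation W := (<<S>>)%g.
Local Notation rdesc := (rdesc S).
Local Notation len := (len S).
Local Notation wle := (wle S).
Local Open Scope order_scope.
Implicit Types (x y z u v : gT) (l : L).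

Lemma quotient_meet x y : x \in W -> y \in W -> exists2 z, z \in W &
  [/\ wle z x, wle z y, f z = f x `&` f y &
      forall u, u \in W -> wle u x -> wle u y -> wle u z].
Proof.
move=> Wx Wy; have [z Wz [zx zy zmax]] := wle_meet coxS Wx Wy; exists z => //.
have [_ fmeet _] := quot; split=> //; apply: fmeet => //.
split; try exact/weak_leP.
by move=> t Wt /weak_leP tx /weak_leP ty; apply/weak_leP => //; apply: zmax; [|apply: tx|apply: ty].
Qed.

Lemma quotient_mono u v : u \in W -> v \in W -> wle u v -> f u <= f v.
Proof.
move=> Wu Wv uv; have [_ fmeet _] := quot; rewrite leEmeet -(fmeet u v u) //.
split; try exact/weak_leP; last by [].
by apply/weak_leP => //; apply: wle_refl.
Qed.

(** Minimality is required against all elements mapping above [l], not only against the fibre of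
    [l]. *)
Definition min_lift l x :=
  [/\ x \in W, f x = l & forall y, y \in W -> l <= f y -> wle x y].

(** Take [x] of least length in the fibre: its meet with any [y] mapping above [l] is again in the
    fibre, hence equals [x]. *)
Lemma min_lift_exists l : exists x, min_lift l x.
Proof.
have [surj _ _] := quot; have [x0 Wx0 fx0] := surj l.
have P0 : (x0 \in W) && (f x0 == l) by rewrite Wx0 fx0 eqxx.
have [x /andP[Wx /eqP fx] xmin] := @arg_minnP gT x0 (fun x => (x \in W) && (f x == l)) len P0.
exists x; split=> // y Wy ly; have [z Wz [zx zy fz _]] := quotient_meet Wx Wy.
suff E : z = x by rewrite -E.
apply: (wle_len_eq Wz Wx zx); apply: xmin; rewrite Wz fz fx.
by apply/eqP/meet_l.
Qed.

Lemma wle_mulr_rdesc x s : x \in W -> s \in S -> rdesc x s -> wle (x * s)%g x.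
Proof.
move=> Wx sS D; rewrite /wle invMg (simple_inv coxS sS) -mulgA mulVg mulg1.
by rewrite (len_simple1 coxS sS) addn1; apply/eqP/len_rdesc.
Qed.

(** An [m] strictly between would lift to some [z] below [x]. Then [x] is the join of [z] and [x s],
    so [l] is the join of [m] and [f (x s)], which is [m]. *)
Lemma min_lift_covby l x s : min_lift l x -> s \in S -> rdesc x s ->
  covby (f (x * s)%g) l.
Proof.
move=> [Wx fx xmin] sS D; have Wxs : (x * s \in W)%g by in_gen.
have xsx := wle_mulr_rdesc Wx sS D; have lxs := len_rdesc coxS Wx sS D.
have [surj _ fjoin] := quot; apply/andP; split.
  rewrite lt_neqAle -{2}fx quotient_mono // andbT; apply/eqP => E.
  by have := wle_len (xmin _ Wxs _); rewrite E lxs ltnn => /(_ (lexx _)).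
apply/forallP => m; apply/negP => /andP[xsm ml].
have [z0 Wz0 fz0] := surj m; have [z Wz [zz0 zx fz _]] := quotient_meet Wz0 Wx.
have {}fz : f z = m by rewrite fz fz0 fx; apply/meet_l/ltW.
suff : f x = f z `|` f (x * s)%g.
  by rewrite fz fx (join_l (ltW xsm)) => E; rewrite E ltxx in ml.
apply: fjoin => //; split; try exact/weak_leP.
move=> t Wt /weak_leP zt /weak_leP xst; apply/weak_leP => //.
(* The meet [g] of [t] and [x] lies between [x s] and [x], whose lengths differ by one. If [g] were
   [x s], then [z] would lie below [x s], giving [m <= f (x s)]. *)
have [g Wg [gt gx _ gmax]] := quotient_meet Wt Wx.
have xsg : wle (x * s)%g g by apply: gmax => //; apply: xst.
have zg : wle z g by apply: gmax => //; apply: zt.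
have [le_g|lt_g] := leqP (len x) (len g).
  by rewrite -(wle_len_eq Wg Wx gx le_g).
have Eg : (x * s)%g = g by apply: (wle_len_eq Wxs Wg xsg); rewrite -ltnS -lxs.
have := quotient_mono Wz Wg zg; rewrite fz -Eg => /(lt_le_trans xsm).
by rewrite ltxx.
Qed.

Lemma min_lift_popdown l x x' s : min_lift l x -> min_lift (popdown l) x' ->
  s \in S -> rdesc x s -> wle x' (x * s)%g.
Proof.
move=> xmin [_ _ x'min] sS D; have [Wx _ _] := xmin.
by apply: x'min; [in_gen | apply: popdown_covby; apply: min_lift_covby].
Qed.

Lemma quotient_bottom l : f 1%g <= l.
Proof.
have [surj _ _] := quot; have [x Wx <-] := surj l.
by apply: quotient_mono => //; apply: wle1.
Qed.

Lemma popdown_subword l x x' w a : min_lift l x -> min_lift (popdown l) x' ->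
  is_word S w -> is_word S a -> uniq a ->
  {in a &, forall s t, ~~ coxeter_graph S s t} ->
  subword_prod (w ++ a) x -> subword_prod w x'.
Proof.
move=> xmin x'min wS aS au nadj; have [Wx fx _] := xmin; have [Wx' _ x'le] := x'min.
have x'x : wle x' x by apply: x'le => //; rewrite fx popdown_le.
apply: (subword_prod_cat coxS wS aS au nadj Wx' x'x) => s sa D.
have sS := allP aS s sa; apply: wle_rdescK => //.
exact: min_lift_popdown xmin x'min sS D.
Qed.

Lemma rdesc_commuting_word w s : is_word S w -> s \in S ->
  {in w &, forall a b, ~~ coxeter_graph S a b} -> rdesc (word_prod w) s -> s \in w.
Proof.
move=> + sS; elim: w => [|a w IH] /=; first by rewrite word_prod_nil (negPf (rdescN1 sS)).
case/andP=> aS wS nadj; rewrite word_prod_cons inE => D.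
have {}IH : rdesc (word_prod w) s -> s \in w.
  by apply: IH => // b c bw cw; apply: nadj; rewrite inE ?bw ?cw orbT.
have [/IH->|Dw] := boolP (rdesc (word_prod w) s); first by rewrite orbT.
have E := exchange coxS (word_in wS) aS sS Dw D.
have comm b : b \in w -> commute a b.
  move=> bw; apply: (nonadjacent_commute coxS aS (allP wS b bw)).
  by apply: nadj; rewrite ?mem_head // inE bw orbT.
have cw : commute a (word_prod w).
  elim: (w) comm => [|b r IHr] comm; first by rewrite word_prod_nil; apply: commute1.
  rewrite word_prod_cons; apply: commuteM; first by apply: comm; rewrite mem_head.
  by apply: IHr => c cr; apply: comm; rewrite inE cr orbT.
by move: E; rewrite cw => /mulgI ->; rewrite eqxx.
Qed.

(** A right descent of [x] would have to occur in the layer of the opposite colour. *)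
Lemma subword_layers_eq1 (col : gT -> bool) x :
  (forall s t, coxeter_graph S s t -> col s != col t) ->
  (forall b, subword_prod (layer S col b) x) -> x = 1%g.
Proof.
move=> colP sub; apply/eqP; apply: contraT => x1.
have Wx : x \in W := subword_prod_in (layer_word S col true) (sub true).
have [s sS D] := rdesc_exists coxS Wx x1; have [w ws wx] := sub (~~ col s).
have := mem_subseq ws; have wS := is_word_subseq (layer_word S col _) ws => wsub.
have : s \in w.
  apply: rdesc_commuting_word; rewrite ?wx // => a b aw bw.
  by apply: (layer_nonadjacent colP (wsub _ aw) (wsub _ bw)).
by move/wsub; rewrite mem_layer sS; case: (col s).
Qed.

Lemma iter_popdown_coxeter_number l : irreducible_coxeter S ->
  iter (coxeter_number S).-1 (@popdown d L) l = f 1%g.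
Proof.
move=> irr; have [col colP] := two_coloring coxS.
set h := coxeter_number S; have h0 : (0 < h)%N by apply: order_gt0.
(* The colour [b] is kept general because dropping the last layer flips it, and both colours are
   needed at the end. *)
have P k b x : (k <= h)%N -> min_lift (iter k (@popdown d L) l) x ->
    subword_prod (layers S col b (h - k)) x.
  elim: k b x => [|k IH] b x lt_k xmin.
    have [Wx _ _] := xmin; apply: (subword_prod_longest coxS) Wx => [|s sS].
      exact: layers_word.
    by rewrite subn0 /h (coxeter_number_layers coxS col); apply: rdesc_alternating_layers.
  have [y ymin] := min_lift_exists (iter k (@popdown d L) l).
  have := IH (~~ b) y (ltnW lt_k) ymin.
  have -> : (h - k = (h - k.+1).+1)%N by rewrite subnSK.
  rewrite layersSr negbK => suby; apply: (popdown_subword ymin xmin) suby.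
  - exact: layers_word.
  - exact: layer_word.
  - exact: layer_uniq.
  - exact: layer_nonadjacent.
have [x xmin] := min_lift_exists (iter h.-1 (@popdown d L) l).
have [_ <- _] := xmin; congr f; apply: (subword_layers_eq1 colP) => b.
have := P h.-1 (~~ b) x (leq_pred h) xmin.
have -> : (h - h.-1 = 1)%N by lia.
by rewrite layersSr negbK.
Qed.

End Quotient.

Theorem theorem9p6 (gT : finGroupType) (S : {set gT})
  (d : Order.disp_t) (L : finLatticeType d) (f : gT -> L) :
  coxeter_system S -> irreducible_coxeter S ->
  weak_lattice_quotient_map S f ->
  forall x : L, #|pop_orbit x| <= coxeter_number S.
Proof.
move=> coxS irr quot x; apply: card_pop_orbit; first exact: order_gt0.
rewrite (iter_popdown_coxeter_number coxS quot x irr); apply: le_anti.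
by rewrite popdown_le (quotient_bottom quot).
Qed.
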